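(* Let $(X,d_X,\mu)$ and $(Y,d_Y,\nu)$ be metric measure spaces, let $1\le q<\infty$, and let $\varphi\colon X\to Y$ be a measurable mapping which induces the bounded composition operator $\varphi^{*}\colon\operatorname{Lip}(Y)\to D^{1,q}(X)$, $\varphi^*(u)=u\circ\varphi$. On the Borel $\sigma$-algebra $\mathscr B(Y)$ define the set function $$\mathscr B(Y)\ni U\mapsto\Psi(U)=\sup\bigg(\int_{\varphi^{-1}(U)}|\nabla_q(u\circ\varphi)|^q\,d\mu\bigg)^{\frac{\sigma}{q}},\qquad \sigma=q,$$ where the supremum is over all $u\in\operatorname{Lip}(Y)$ with $\operatorname{Lip}(u)\le1$. Then $\Psi$ extends to a regular Borel measure $\widetilde\Psi$ on $Y$ given by $$\widetilde\Psi(A)=\inf\{\Psi(B)\mid A\subset B,\ B\in\mathscr B(Y)\},\qquad A\subset Y.$$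
   Context: A metric measure space $(X,d_X,\mu)$ is a separable metric space $(X,d_X)$ with a nontrivial regular Borel measure $\mu$ that is finite on bounded sets. Measures are outer measures; a regular Borel measure is an outer measure for which all Borel sets are measurable and every set is contained in a Borel set of the same measure. For $1\le q<\infty$, $D^{1,q}(X)$ is the Dirichlet (homogeneous Sobolev) space of measurable functions $u\colon X\to\mathbb R$ having an upper gradient in $L^q(X,\mu)$; $|\nabla_q u|$ denotes the minimal $q$-weak upper gradient of $u$. $\operatorname{Lip}(Y)$ is the space of Lipschitz functions $u\colon Y\to\mathbb R$, and $\operatorname{Lip}(u)=\sup_{x\ne y}|u(x)-u(y)|/d_Y(x,y)$. $\varphi$ induces the bounded composition operator $\varphi^*\colon\operatorname{Lip}(Y)\to D^{1,q}(X)$ if $u\circ\varphi\in D^{1,q}(X)$ for every $u\in\operatorname{Lip}(Y)$ and there is a constant $C<\infty$ with $\big(\int_X|\nabla_q(u\circ\varphi)|^q\,d\mu\big)^{1/q}\le C\operatorname{Lip}(u)$ for all $u\in\operatorname{Lip}(Y)$. *)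

(* Defs.v *)
From HB Require Import structures.
From mathcomp Require Import all_boot all_order all_algebra.
From mathcomp Require Import all_classical all_reals all_analysis measurable_realfun.

Set Implicit Arguments.
Unset Strict Implicit.
Unset Printing Implicit Defensive.

Import Order.TTheory GRing.Theory Num.Theory.
Import numFieldNormedType.Exports.

Local Open Scope classical_set_scope.
Local Open Scope ring_scope.

(* The base point only serves to make X a measurable type of the library; it
   plays no other role.  A space carrying a nontrivial measure is nonempty. *)
#[short(type="pointedMetricType")]
HB.structure Definition PointedMetric (R : numDomainType) :=
  {M of Pointed M & Metric R M}.

Notation borel_type X := (g_sigma_algebraType (@open X)).

Section metric_measure_spaces.
Context {R : realType} (X : pointedMetricType R).

Definition borel : set (set X) := <<s @open X >>.

Definition separable := exists D : set X, countable D /\ dense D.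

Definition metric_bounded (A : set X) := exists x r, A `<=` ball x r.

Implicit Type mu : {outer_measure set X -> \bar R}.

Definition regular_borel mu :=
  borel `<=` mu.-caratheodory /\
  forall A, exists B, [/\ borel B, A `<=` B & mu B = mu A].

Definition metric_measure_space mu := [/\ separable,
  regular_borel mu,
  mu [set: X] <> 0%E &
  forall A, metric_bounded A -> (mu A < +oo)%E].

(* The measure obtained by restricting mu to its Caratheodory-measurable sets:
   "mu-measurable" and "dmu" refer to this measure. *)
Definition cara_measure mu : {measure set (caratheodory_type mu) -> \bar R} :=
  (mu : set (caratheodory_type mu) -> \bar R).

End metric_measure_spaces.

Section curves.
Context {R : realType} (X : metricType R).

(* Compact curves `[cstart, cend] -> X; the values of the underlying total
   function outside of the interval are irrelevant. *)
Record curve := Curve {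
  cmap :> R -> X ;
  cstart : R ;
  cend : R ;
  cstart_le_cend : cstart <= cend ;
  curve_continuous : {within `[cstart, cend], continuous cmap} }.

Definition path_variation (a b : R) (f : R -> X) (s : seq R) : R :=
  let F := f \o nth b (a :: s) in
  \sum_(0 <= n < size s) mdist (F n) (F n.+1).

Definition path_length (f : R -> X) (a b : R) : \bar R :=
  ereal_sup [set (path_variation a b f s)%:E | s in itv_partition a b].

Implicit Type c : curve.

Definition curve_length c := path_length c (cstart c) (cend c).

Definition rectifiable c := (curve_length c < +oo)%E.

(* Arc-length parametrization of a rectifiable curve, on [0, curve_length c]:
   c evaluated at the last parameter r at which the length of the restriction
   of c to [cstart c, r] equals t. *)
Definition arc_length_param c (t : R) : X :=
  c (sup [set r | cstart c <= r <= cend c /\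
                  path_length c (cstart c) r = t%:E]).

Definition line_integral (g : X -> \bar R) c : \bar R :=
  (\int[lebesgue_measure]_(t in `[0%R, fine (curve_length c)])
     g (arc_length_param c t))%E.

Definition upper_gradient_ineq (u : X -> R) (g : X -> \bar R) c :=
  (`|u (c (cend c)) - u (c (cstart c))|%:E <= line_integral g c)%E.

End curves.

Section upper_gradients.
Context {R : realType} {X : pointedMetricType R}.
Variable mu : {outer_measure set X -> \bar R}.
Implicit Types (u : X -> R) (g : X -> \bar R) (q : R).
Local Open Scope ereal_scope.

Definition nonneg_borel_fun g :=
  measurable_fun [set: borel_type X] (g : borel_type X -> \bar R) /\
  forall x, 0 <= g x.

Definition q_energy q (A : set X) g : \bar R :=
  \int[cara_measure mu]_(x in (A : set (caratheodory_type mu))) (g x `^ q).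

Definition upper_gradient u g := nonneg_borel_fun g /\
  forall c : curve X, rectifiable c -> upper_gradient_ineq u g c.

Definition admissible (Gamma : set (curve X)) g := nonneg_borel_fun g /\
  forall c, Gamma c -> rectifiable c -> 1 <= line_integral g c.

Definition modulus q (Gamma : set (curve X)) : \bar R :=
  ereal_inf [set q_energy q setT g | g in admissible Gamma].

Definition weak_upper_gradient q u g := nonneg_borel_fun g /\
  modulus q [set c : curve X | rectifiable c /\ ~ upper_gradient_ineq u g c] = 0.

Definition minimal_weak_upper_gradient q u g := [/\
  weak_upper_gradient q u g,
  q_energy q setT g < +oo &
  forall h, weak_upper_gradient q u h -> q_energy q setT h < +oo ->
    {ae cara_measure mu, forall x, g x <= h x}].

(* |nabla_q u|: a representative of the minimal q-weak upper gradient, which is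
   unique up to mu-null sets and exists for every u in D^{1,q}(X). *)
Definition nabla q u : X -> \bar R :=
  xget (fun=> 0) (minimal_weak_upper_gradient q u).

Definition dirichlet q u :=
  measurable_fun [set: caratheodory_type mu] (u : caratheodory_type mu -> R) /\
  exists2 g, upper_gradient u g & q_energy q setT g < +oo.

End upper_gradients.

Section lipschitz_functions.
Context {R : realType} {Y : metricType R}.
Implicit Type u : Y -> R.

Definition lipschitz_fun u :=
  exists L : R, forall x y, `|u x - u y| <= L * mdist x y.

(* 0 is added to the set so that the supremum is 0 on a one-point space. *)
Definition lip_const u : \bar R :=
  ereal_sup ([set 0%E] `|` [set e | exists x y : Y,
    x != y /\ e = (`|u x - u y| / mdist x y)%:E]).

End lipschitz_functions.

Section composition_operator.
Context {R : realType} {X Y : pointedMetricType R}.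
Variables (mu : {outer_measure set X -> \bar R}) (q : R) (phi : X -> Y).
Local Open Scope ereal_scope.

Definition measurable_mapping :=
  measurable_fun [set: caratheodory_type mu]
    (phi : caratheodory_type mu -> borel_type Y).

Definition bounded_composition_operator :=
  (forall u : Y -> R, lipschitz_fun u -> dirichlet mu q (u \o phi)) /\
  exists C : R, forall u : Y -> R, lipschitz_fun u ->
    q_energy mu q setT (nabla mu q (u \o phi)) `^ q^-1 <= C%:E * lip_const u.

Definition Psi (sigma : R) (U : set Y) : \bar R :=
  ereal_sup [set
    q_energy mu q (phi @^-1` U) (nabla mu q (u \o phi)) `^ (sigma / q)
  | u in [set u : Y -> R | lipschitz_fun u /\ lip_const u <= 1]].

End composition_operator.

Definition borel_inf_extension {R : realType} {Y : pointedMetricType R}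
    (F : set Y -> \bar R) (A : set Y) : \bar R :=
  ereal_inf [set F B | B in [set B | A `<=` B /\ borel B]].

(* Main.v *)
Require Import Defs.
From HB Require Import structures.
From mathcomp Require Import all_boot all_order all_algebra.
From mathcomp Require Import all_classical all_reals all_analysis measurable_realfun.
From mathcomp Require Import lra.

Set Implicit Arguments.
Unset Strict Implicit.
Unset Printing Implicit Defensive.

Import Order.TTheory GRing.Theory Num.Theory.
Import numFieldNormedType.Exports.

Local Open Scope classical_set_scope.
Local Open Scope ring_scope.

(* For fixed u, U |-> int_(phi^-1 U) |nabla_q (u o phi)|^q is a finite Borel
   measure on Y, and Psi is the supremum of these measures over the 1-Lipschitz u;
   hence Psi is monotone and countably subadditive on Borel sets, and its extension
   is an outer measure whose infimum is attained. It remains to see that a closed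
   set C splits Psi additively. Given 1-Lipschitz u1, u2 and D = {y : d(y, C) >= e},
   replace u1 on C and u2 on D by their sawtooth T o u_i, where T is the distance to
   2 e Z. As 0 <= T <= e, the result is 1-Lipschitz on the union of C and D, and it
   extends to a 1-Lipschitz function v on Y by McShane's formula. Since
   u_i = v + 2 e k or u_i = - v + 2 e k locally, locality of minimal weak upper
   gradients shows that v is as good as u1 on C and as u2 on D. Let e tend to 0.

   Locality and the existence of minimal weak upper gradients both come from a
   gluing principle: if g and g' are weak upper gradients of u and h, and u = h on
   the Borel set B, then g off B, g' on B is one of u. Along almost every curve this
   reduces to a statement on intervals, which is obtained by chaining short
   segments, without differentiating along the curve. *)

(** * Length and arc-length parametrization of curves *)

Section path_length_theory.
Context {R : realType} {X : metricType R}.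
Implicit Types (f : R -> X) (a b : R) (s t : seq R).

(** Recursive form of [path_variation]: carrying the current base point as an argument allows
    induction on the partition in place of index arithmetic. *)
Fixpoint chain_length f a s : R :=
  if s is x :: s' then mdist (f a) (f x) + chain_length f x s' else 0.

Lemma path_variationE a b f s : path_variation a b f s = chain_length f a s.
Proof.
elim: s a => [|x s IH] a; first by rewrite /path_variation big_nil.
rewrite /= -IH /path_variation /= big_nat_recl//=.
Qed.

Lemma chain_length_ge0 f a s : 0 <= chain_length f a s.
Proof. by elim: s a => //= x s IH a; rewrite addr_ge0 ?mdist_ge0. Qed.

Lemma chain_length_cat f a s t :
  chain_length f a (s ++ t) = chain_length f a s + chain_length f (last a s) t.
Proof. by elim: s a => /= [|x s IH] a; rewrite ?add0r// IH addrA. Qed.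

(** Inserting the point r into a partition can only increase the sum, by the triangle inequality. *)
Lemma chain_length_split f a b r s : itv_partition a b s -> a <= r <= b ->
  exists s1 s2, [/\ itv_partition a r s1, itv_partition r b s2 &
    chain_length f a s <= chain_length f a s1 + chain_length f r s2].
Proof.
elim: s a => [|x s IH] a.
  move=> [_ /= /eqP <-] /andP[ar ra].
  have -> : r = a by apply/le_anti; rewrite ra ar.
  by exists [::], [::]; split => //=; rewrite addr0.
move=> abs; have [/= /andP[ax pxs] lxs] := abs => /andP[ar rb].
have [rx|xr] := ltP r x.
  (* [itv_partition] is strictly increasing, so for r = a the left part has to be the empty
     partition. *)
  have [<-|nar] := eqVneq a r.
    by exists [::], (x :: s); split => //=; rewrite add0r.
  exists [:: r], (x :: s); split => /=.
  - by apply: itv_partition1; rewrite lt_neqAle nar.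
  - by split => //=; rewrite rx.
  - by rewrite addr0 addrA lerD2r metric_triangle.
have [||s1 [s2 [[ps1 ls1] xs2 le12]]] := IH x; rewrite ?xr//.
exists (x :: s1), s2; split => //=; last by rewrite -addrA lerD2l.
by split => //=; rewrite ax.
Qed.

Lemma chain_length_le f a b s : itv_partition a b s ->
  ((chain_length f a s)%:E <= path_length f a b)%E.
Proof.
by move=> abs; apply: ereal_sup_ubound; exists s => //=; rewrite path_variationE.
Qed.

Lemma path_length_le f a b (z : \bar R) :
  (forall s, itv_partition a b s -> ((chain_length f a s)%:E <= z)%E) ->
  (path_length f a b <= z)%E.
Proof.
by move=> H; apply: ge_ereal_sup => _ [s abs <-]; rewrite path_variationE; exact: H.
Qed.

Lemma path_length_dist f a b : a <= b ->
  ((mdist (f a) (f b))%:E <= path_length f a b)%E.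
Proof.
rewrite le_eqVlt => /predU1P[<-|ab].
  by rewrite mdistxx; apply: (@chain_length_le _ _ _ [::]); split => //=.
have := chain_length_le f (itv_partition1 ab).
by rewrite /= addr0.
Qed.

Lemma path_length_ge0 f a b : a <= b -> (0 <= path_length f a b)%E.
Proof. by move/(path_length_dist f); apply: le_trans; rewrite lee_fin mdist_ge0. Qed.

Lemma path_length_fin_approx f a b : (path_length f a b < +oo)%E -> a <= b ->
  forall e, 0 < e -> exists2 s, itv_partition a b s &
    fine (path_length f a b) - e < chain_length f a s.
Proof.
move=> fin ab e e0.
have fn : path_length f a b \is a fin_num by rewrite ge0_fin_numE ?path_length_ge0.
have [_ [s abs <-] H] := ub_ereal_sup_adherent e0 fn.
by exists s => //; rewrite -lte_fin EFinB fineK// -(path_variationE a b).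
Qed.

(** One inequality splits partitions of [a, b] at r, the other concatenates partitions of the two
    pieces. *)
Lemma path_lengthD f a r b : a <= r -> r <= b ->
  path_length f a b = (path_length f a r + path_length f r b)%E.
Proof.
move=> ar rb; apply/eqP; rewrite eq_le; apply/andP; split.
  apply: path_length_le => s abs.
  have [|s1 [s2 [s1P s2P le12]]] := chain_length_split f abs (r := r).
    by rewrite ar.
  apply: (@le_trans _ _ (chain_length f a s1 + chain_length f r s2)%:E);
    first by rewrite lee_fin.
  by rewrite EFinD leeD// chain_length_le.
have cat s1 s2 : itv_partition a r s1 -> itv_partition r b s2 ->
    ((chain_length f a s1)%:E + (chain_length f r s2)%:E <= path_length f a b)%E.
  move=> s1P s2P; have [_ /eqP l1] := s1P.
  have := chain_length_le f (itv_partition_cat s1P s2P).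
  by rewrite chain_length_cat l1.
(* The two suprema are taken one after the other, moving the other term across by subtraction, which
   requires finite lengths. *)
have [->|abfin] := eqVneq (path_length f a b) +oo%E; first by rewrite leey.
have abfn : path_length f a b \is a fin_num.
  by rewrite ge0_fin_numE ?path_length_ge0 ?(le_trans ar)// ltey.
have rbfn : path_length f r b \is a fin_num.
  rewrite ge0_fin_numE ?path_length_ge0//.
  apply: (@le_lt_trans _ _ (path_length f a b)); last by rewrite ltey.
  apply: path_length_le => s2 s2P; have [s1 s1P] : exists s1, itv_partition a r s1.
    move: ar; rewrite le_eqVlt => /predU1P[<-|/itv_partition1]; last by eexists; eauto.
    by exists [::]; split => /=.
  apply: le_trans (cat _ _ s1P s2P).
  by rewrite leeDr// lee_fin chain_length_ge0.
rewrite -leeBrDr//; apply: path_length_le => s1 s1P.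
rewrite leeBrDr// addeC -leeBrDr//; apply: path_length_le => s2 s2P.
by rewrite leeBrDr// addeC; exact: cat.
Qed.

End path_length_theory.

Section arc_length.
Context {R : realType} {X : metricType R}.
Implicit Type c : curve X.

Lemma curve_cvg c r e : cstart c <= r <= cend c -> 0 < e ->
  exists2 d, 0 < d & forall y, cstart c <= y <= cend c -> `|r - y| < d ->
    mdist (c r) (c y) < e.
Proof.
move=> rab e0; have /subspace_continuousP cc := @curve_continuous _ _ c.
have rI : `[cstart c, cend c]%classic r by rewrite /= in_itv.
have /metricType_numDomainType.cvgr_dist_lt/(_ e e0) := cc r rI.
rewrite near_withinE => /nbhs_ballP[d /= d0 H]; exists d => // y yab ry.
by apply: H => //=; rewrite in_itv.
Qed.

(** Real-valued length, for use in linear arithmetic; on subintervals of a rectifiable curve [fine]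
    loses nothing, by [sub_lengthE]. *)
Definition sub_length c (x y : R) : R := fine (path_length c x y).

Section rectifiable_curve.
Variable c : curve X.
Hypothesis rc : rectifiable c.
Local Notation a := (cstart c).
Local Notation b := (cend c).
Local Notation L := (sub_length c a).

Lemma sub_path_length_fin x y : a <= x -> x <= y -> y <= b ->
  path_length c x y \is a fin_num.
Proof.
move=> ax xy yb; rewrite ge0_fin_numE ?path_length_ge0//.
apply: le_lt_trans rc; rewrite /curve_length (path_lengthD c ax (le_trans xy yb)).
rewrite (path_lengthD c xy yb);
  apply: (@le_trans _ _ (path_length c x y + path_length c y b)%E).
  by rewrite leeDl// path_length_ge0.
by rewrite leeDr// path_length_ge0.
Qed.

Lemma sub_lengthE x y : a <= x -> x <= y -> y <= b ->
  (sub_length c x y)%:E = path_length c x y.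
Proof. by move=> ax xy yb; rewrite fineK// sub_path_length_fin. Qed.

Lemma sub_lengthD x y z : a <= x -> x <= y -> y <= z -> z <= b ->
  sub_length c x z = sub_length c x y + sub_length c y z.
Proof.
move=> ax xy yz zb; apply: EFin_inj.
have ay := le_trans ax xy; have yb := le_trans yz zb.
by rewrite EFinD !sub_lengthE// ?(path_lengthD c xy yz)// (le_trans xy yz).
Qed.

Lemma sub_length_dist x y : a <= x -> x <= y -> y <= b ->
  mdist (c x) (c y) <= sub_length c x y.
Proof.
by move=> ax xy yb; rewrite -lee_fin sub_lengthE// path_length_dist.
Qed.

Lemma sub_length_ge0 x y : a <= x -> x <= y -> y <= b -> 0 <= sub_length c x y.
Proof. by move=> *; rewrite (le_trans _ (sub_length_dist _ _ _))// mdist_ge0. Qed.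

Lemma sub_lengthB x y : a <= x -> x <= y -> y <= b ->
  sub_length c x y = L y - L x.
Proof. by move=> ax xy yb; rewrite (sub_lengthD (lexx a) ax xy yb) addrAC subrr add0r. Qed.

Lemma chain_sub_length x y s : a <= x -> x <= y -> y <= b ->
  itv_partition x y s -> chain_length c x s <= sub_length c x y.
Proof. by move=> ax xy yb xys; rewrite -lee_fin sub_lengthE// chain_length_le. Qed.

Lemma sub_length_approx x y e : a <= x -> x <= y -> y <= b -> 0 < e ->
  exists2 s, itv_partition x y s & sub_length c x y - e < chain_length c x s.
Proof.
move=> ax xy yb e0; apply: path_length_fin_approx => //.
by rewrite -ge0_fin_numE ?sub_path_length_fin ?path_length_ge0.
Qed.

(** Take a partition of [r, b] whose sum is within e / 2 of the length. Moving its starting point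
    from r to some y before its first point x changes the sum by at most d(c r, c y). Hence the
    length over [r, y] is below e / 2 + d(c r, c y), which continuity of the curve makes small. *)
Lemma sub_length_right_small r e : a <= r -> r <= b -> 0 < e ->
  exists2 d, 0 < d & forall y, r <= y -> y <= b -> y - r < d ->
    sub_length c r y < e.
Proof.
move=> ar; rewrite le_eqVlt => /predU1P[rb|rb] e0.
  exists 1 => // y ry yb _; have yr : y = r by apply/le_anti; rewrite ry andbT rb.
  rewrite yr; apply: le_lt_trans e0.
  by rewrite (sub_lengthB ar (lexx r)) ?subrr// rb.
have e20 : 0 < e / 2 by rewrite divr_gt0.
have [s sP sL] := sub_length_approx ar (ltW rb) (lexx b) e20.
case: s sP sL => [[_ /= /eqP rb']|x s [/= /andP[rx xs] ls] sL].
  by rewrite rb' ltxx in rb.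
have rab : a <= r <= b by rewrite ar ltW.
have [d d0 dP] := curve_cvg rab e20.
exists (Num.min d (x - r)); first by rewrite lt_min d0 subr_gt0.
move=> y ry yb; rewrite lt_min => /andP[yd yx].
have {}yx : y < x by rewrite ltrD2r in yx.
have ay := le_trans ar ry.
have := dP y; rewrite ay yb distrC ger0_norm ?subr_ge0// => /(_ isT yd) cd.
have := @chain_sub_length y b (x :: s) ay yb (lexx b).
have yP : itv_partition y b (x :: s) by split => //=; rewrite yx.
move=> /(_ yP); rewrite (sub_lengthD ar ry yb (lexx b)) in sL.
have /= := metric_triangle (c r) (c y) (c x).
by lra.
Qed.

(** Mirror image of the previous argument, moving the endpoint r within the last interval of a
    partition of [a, r]. *)
Lemma sub_length_left_small r e : a <= r -> r <= b -> 0 < e ->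
  exists2 d, 0 < d & forall y, a <= y -> y <= r -> r - y < d ->
    sub_length c y r < e.
Proof.
rewrite le_eqVlt => /predU1P[ra|ar] rb e0.
  exists 1 => // y ay yr _; have yra : y = r by apply/le_anti; rewrite yr -ra ay.
  rewrite yra; apply: le_lt_trans e0.
  by rewrite (sub_lengthB _ (lexx r)) ?subrr// ra.
have e20 : 0 < e / 2 by rewrite divr_gt0.
have [s] := sub_length_approx (lexx a) (ltW ar) rb e20.
case/lastP: s => [[_ /= /eqP ra']|s x].
  by rewrite ra' ltxx in ar.
move=> [/= + /[!last_rcons]/eqP xr]; rewrite {x}xr rcons_path => /andP[ps lr] sL.
have rab : a <= r <= b by rewrite rb ltW.
have [d d0 dP] := curve_cvg rab e20.
set x := last a s in lr.
exists (Num.min d (r - x)); first by rewrite lt_min d0 subr_gt0.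
move=> y ay yr; rewrite lt_min => /andP[yd yx].
have {}yx : x < y by rewrite -subr_gt0; lra.
have yb := le_trans yr rb.
have := dP y; rewrite ay yb ger0_norm ?subr_ge0// => /(_ isT yd) cd.
have := @chain_sub_length a y (rcons s y) (lexx a) ay yb.
have yP : itv_partition a y (rcons s y).
  by split => //=; rewrite ?last_rcons// rcons_path ps.
move=> /(_ yP); rewrite (sub_lengthD (lexx a) ay yr rb) in sL.
move: sL; rewrite -!cats1 !chain_length_cat /= !addr0 -/x => sL.
have /= := metric_triangle (c x) (c y) (c r).
have : mdist (c y) (c r) = mdist (c r) (c y) by rewrite metric_sym.
by lra.
Qed.

Lemma sub_length_homo x y : a <= x -> x <= y -> y <= b -> L x <= L y.
Proof.
by move=> ax xy yb; rewrite -subr_ge0 -sub_lengthB// sub_length_ge0.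
Qed.

Lemma length_dist x y : a <= x <= b -> a <= y <= b ->
  mdist (c x) (c y) <= `|L x - L y|.
Proof.
wlog xy : x y / x <= y => [H|/andP[ax xb] /andP[ay yb]].
  have [/H//|/ltW yx hx hy] := leP x y.
  by rewrite metric_sym distrC; exact: H.
rewrite distrC ger0_norm; last by rewrite subr_ge0 sub_length_homo.
by rewrite -sub_lengthB// sub_length_dist.
Qed.

Lemma length_continuous : {within `[a, b], continuous L}.
Proof.
apply/subspace_continuousP => r /=; rewrite in_itv/= => /andP[ar rb].
apply/cvgrPdist_lt => e e0; rewrite near_withinE.
have [d1 d10 H1] := sub_length_left_small ar rb e0.
have [d2 d20 H2] := sub_length_right_small ar rb e0.
apply/nbhs_ballP; exists (Num.min d1 d2); first by rewrite /= lt_min d10.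
move=> y /=; rewrite /ball/= lt_min in_itv/= => /andP[yd1 yd2] /andP[ay yb].
have [yr|/ltW ry] := leP y r.
  rewrite -sub_lengthB// ger0_norm ?sub_length_ge0//; apply: H1 => //.
  by rewrite ger0_norm ?subr_ge0 in yd1.
rewrite distrC -sub_lengthB// ger0_norm ?sub_length_ge0//; apply: H2 => //.
by rewrite distrC ger0_norm ?subr_ge0 in yd2.
Qed.

Lemma length_start : L a = 0.
Proof. by have := @sub_lengthB a a (lexx _) (lexx _) (cstart_le_cend c); lra. Qed.

Lemma length_surj t : 0 <= t <= L b -> exists2 r, a <= r <= b & L r = t.
Proof.
move=> /andP[t0 tb]; have [|r] := IVT (v := t) (cstart_le_cend c) length_continuous.
  by rewrite length_start ge_min t0 le_max tb orbT.
by rewrite in_itv/= => rab; exists r.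
Qed.

(** By [length_dist] the curve is constant on each level set of the length function. Continuity of
    [c] extends this to the supremum of the level set, where [arc_length_param] evaluates the
    curve. *)
Lemma arc_length_paramE r : a <= r <= b -> arc_length_param c (L r) = c r.
Proof.
move=> rab; rewrite /arc_length_param.
set E := [set _ | _]; have EE : E = [set x | a <= x <= b /\ L x = L r].
  apply/seteqP; split => x /= [/andP[ax xb] xr]; split; rewrite ?ax//.
    by apply: EFin_inj; rewrite sub_lengthE.
  by rewrite -sub_lengthE// xr.
have supE : has_sup E.
  by split; [exists r; rewrite EE|exists b; rewrite EE => x [/andP[]]].
have Er : E r by rewrite EE.
have rs : r <= sup E by exact: ub_le_sup supE.2 _ Er.
have sb : sup E <= b by apply: ge_sup supE.1 _ => x; rewrite EE => -[/andP[]].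
have [ar rb] := andP rab.
have sab : a <= sup E <= b by rewrite sb (le_trans ar rs).
apply/mdist_positivity/le_anti; rewrite mdist_ge0 andbT.
apply/ler_addgt0Pl => e e0; rewrite addr0.
have [d d0 dP] := curve_cvg sab e0.
have [x Ex sx] := sup_adherent d0 supE.
have xs : x <= sup E by exact: ub_le_sup supE.2 _ Ex.
have [xab xr] : a <= x <= b /\ L x = L r by move: Ex; rewrite EE.
have cx : mdist (c (sup E)) (c x) <= e.
  by apply/ltW/dP => //; rewrite ger0_norm ?subr_ge0// ltrBlDr -ltrBlDl.
apply: le_trans cx.
suff -> : c r = c x by [].
apply/mdist_positivity/le_anti; rewrite mdist_ge0 andbT.
by rewrite (le_trans (length_dist rab xab))// xr subrr normr0.
Qed.

Lemma curve_lengthE : curve_length c = (L b)%:E.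
Proof. by rewrite sub_lengthE// cstart_le_cend. Qed.

End rectifiable_curve.

(* Constant outside of [0, curve_length c], hence 1-Lipschitz on the whole line,
   unlike [arc_length_param c] whose outer values are junk. *)
Definition arc_length_ext c (t : R) : X :=
  arc_length_param c (Num.max 0 (Num.min t (fine (curve_length c)))).

Lemma arc_length_extE c t : 0 <= t <= fine (curve_length c) ->
  arc_length_ext c t = arc_length_param c t.
Proof.
by move=> /andP[t0 tl]; rewrite /arc_length_ext (min_idPl tl) (max_idPr t0).
Qed.

Lemma line_integralE (g : X -> \bar R) c : line_integral g c =
  (\int[lebesgue_measure]_(t in `[0%R, fine (curve_length c)])
     g (arc_length_ext c t))%E.
Proof.
by apply: eq_integral => t; rewrite inE/= in_itv/= => /arc_length_extE ->.
Qed.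

Lemma curve_length_ge0 c : 0 <= fine (curve_length c).
Proof. by rewrite fine_ge0// path_length_ge0// cstart_le_cend. Qed.

(** The clamping [k] onto [0, l] is 1-Lipschitz; writing the clamped values as lengths L x and L y
    reduces the claim to [length_dist]. *)
Lemma arc_length_ext_lip c s t : rectifiable c ->
  mdist (arc_length_ext c s) (arc_length_ext c t) <= `|s - t|.
Proof.
move=> rc; have := curve_length_ge0 c.
have lE : fine (curve_length c) = sub_length c (cstart c) (cend c) by rewrite curve_lengthE.
rewrite /arc_length_ext; set l := fine _ => l0.
pose k (t : R) := Num.max 0 (Num.min t l).
have kb u : 0 <= k u <= l.
  by rewrite /k; rewrite le_max lexx/= ge_max l0 ge_min lexx orbT.
have klip : `|k s - k t| <= `|s - t|.
  rewrite /k; case: (leP s l); case: (leP t l) => ? ?;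
  (case: (leP 0 s); case: (leP 0 t) => ? ?) => //=; rewrite ?maxEle;
  rewrite ler_norml; do ?[case: ifPn => ?] ; case: (ger0P (s - t)); lra.
apply: le_trans klip; have := @length_surj c rc; have := kb t; have := kb s;
  rewrite -/(k s) -/(k t) -lE.
move=> kss ktt surj; move: ktt kss => /surj[x xab <-] /surj[y yab <-].
by rewrite !arc_length_paramE// length_dist.
Qed.

Lemma arc_length_ext_start c : rectifiable c -> arc_length_ext c 0 = c (cstart c).
Proof.
move=> rc; rewrite arc_length_extE ?lexx ?curve_length_ge0//.
by rewrite -(length_start rc) arc_length_paramE// lexx cstart_le_cend.
Qed.

Lemma arc_length_ext_end c : rectifiable c ->
  arc_length_ext c (fine (curve_length c)) = c (cend c).
Proof.
move=> rc; rewrite arc_length_extE ?lexx ?curve_length_ge0//.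
by rewrite curve_lengthE//= arc_length_paramE// lexx cstart_le_cend.
Qed.

Lemma subcurveP c s t : rectifiable c ->
  0 <= s -> s <= t -> t <= fine (curve_length c) ->
  exists c' : curve X, [/\ rectifiable c',
    c' (cstart c') = arc_length_ext c s, c' (cend c') = arc_length_ext c t,
    fine (curve_length c') = t - s &
    forall x, 0 <= x <= t - s -> arc_length_ext c' x = arc_length_ext c (s + x)].
Proof.
move=> rc s0 st tl; have sl := le_trans st tl; have t0 := le_trans s0 st.
have lE : fine (curve_length c) = sub_length c (cstart c) (cend c) by rewrite curve_lengthE.
have [|x xab xs] := @length_surj c rc s; first by rewrite s0 -lE.
have [y [yab xy yt]] : exists y, [/\ cstart c <= y <= cend c, x <= y & sub_length c (cstart c) y = t].
  have [|y yab yt] := @length_surj c rc t; first by rewrite t0 -lE.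
  (* Parameters of lengths s and t can come in the wrong order only when s = t, and then x serves
     for both. *)
  have [xy|yx] := leP x y; first by exists y.
  exists x; split => //; apply/le_anti; rewrite xs st /= -yt -xs.
  by case/andP: xab; case/andP: yab => *; apply: sub_length_homo => //; exact: ltW.
have [ax xb] := andP xab; have [ay yb] := andP yab.
have cxy : {within `[x, y], continuous c}.
  apply: continuous_subspaceW (@curve_continuous _ _ c).
  by apply: subset_itv; rewrite bnd_simp.
pose c' := Curve xy cxy.
have rc' : rectifiable c'.
  by rewrite /rectifiable /curve_length/= -ge0_fin_numE ?path_length_ge0//;
    exact: sub_path_length_fin.
have lc' : fine (curve_length c') = t - s.
  by rewrite curve_lengthE//= -[sub_length c' _ _]/(sub_length c x y) sub_lengthB// xs yt.
have pE r : cstart c <= r <= cend c -> arc_length_ext c (sub_length c (cstart c) r) = c r.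
  move=> /andP[ar rb]; rewrite arc_length_extE ?arc_length_paramE ?ar//.
  by rewrite lE !sub_length_homo ?sub_length_ge0.
exists c'; split => //.
- by rewrite -xs pE.
- by rewrite -yt pE.
- move=> z zts; have [|r /andP[xr ry] rz] := @length_surj c' rc' z.
    by rewrite -[sub_length _ _ _]/(fine (curve_length c')) lc'.
  rewrite /= in xr ry; have ar := le_trans ax xr; have rb := le_trans ry yb.
  have -> : s + z = sub_length c (cstart c) r.
    by rewrite -rz -xs -[sub_length c' _ _]/(sub_length c x r) -sub_lengthD.
  rewrite pE ?ar//.
  rewrite arc_length_extE ?lc'//.
  by rewrite -rz arc_length_paramE//= ?xr.
Qed.

End arc_length.

(** * Gluing of one-dimensional upper gradient inequalities *)

Section integral_small.
Context d (T : measurableType d) (R : realType) (m : {measure set T -> \bar R}).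
Local Open Scope ereal_scope.

(** Absolute continuity of the integral for extended-valued integrands: integrability makes g finite
    almost everywhere, so [fine] yields a real function to which [integral_normr_continuous]
    applies. *)
Lemma integral_small (D : set T) (g : T -> \bar R) (e : R) :
  measurable D -> measurable_fun D g -> (forall x, 0 <= g x) ->
  \int[m]_(x in D) g x < +oo -> (0 < e)%R ->
  exists2 r : R, (0 < r)%R & forall A, measurable A -> m A < r%:E ->
    \int[m]_(x in D `&` A) g x < e%:E.
Proof.
move=> mD mg g0 foo e0.
have gD0 x : 0 <= (g \_ D) x by apply: erestrict_ge0.
have ig : m.-integrable setT (g \_ D).
  apply/(integrable_mkcond _ mD)/integrableP; split => //.
  by under eq_integral do rewrite gee0_abs//.
have mgD : measurable_fun setT (g \_ D) by exact/(measurable_restrictT _ mD).1.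
pose f := fine \o (g \_ D).
have fg : ae_eq m setT (g \_ D) (EFin \o f).
  apply: filterS (integrable_ae measurableT ig) => x /(_ I) fx _.
  by rewrite /f/= fineK.
have mf : measurable_fun setT (EFin \o f) by apply/measurable_EFinP; exact: measurableT_comp.
have f_int : m.-integrable setT (EFin \o f).
  apply: (fun H => le_integrable measurableT mf H ig) => x _;
    rewrite /f/= ger0_norm ?fine_ge0// gee0_abs//.
  by case: ((g \_ D) x) (gD0 x).
have [r [r0 rP]] := integral_normr_continuous f_int e0.
exists r => // A mA Ar; have := rP A mA Ar.
rewrite -lte_fin; apply: le_lt_trans.
rewrite /Rintegral fineK; last first.
  have fA : m.-integrable A (EFin \o f) by exact: integrableS f_int.
  by have /integrable_fin_num -/(_ mA) := integrable_abse fA.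
rewrite integral_mkcondl (@ge0_ae_eq_integral _ _ _ m A (g \_ D) (fun x => `|f x|%:E))//.
- exact: measurable_funTS.
- apply: measurable_funTS; apply/measurable_EFinP; apply: measurableT_comp => //.
  exact/measurable_EFinP.
- apply: filterS fg => x /(_ I) -> _; rewrite /f/= ger0_norm//.
  exact: fine_ge0.
Qed.

End integral_small.

Section interval_integral.
Context (R : realType).
Local Notation mu := (@lebesgue_measure R).
Implicit Types (k : R -> \bar R) (a b s t x : R).

Lemma integral_itvD k r s t : measurable_fun setT k -> (forall x, (0 <= k x)%E) ->
  r <= s -> s <= t ->
  (\int[mu]_(x in `[r, t]) k x =
   \int[mu]_(x in `[r, s]) k x + \int[mu]_(x in `[s, t]) k x)%E.
Proof.
move=> mk k0 rs st.
rewrite -(@integral_itv_obnd_cbnd _ s) ; last exact: measurable_funTS.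
rewrite -ge0_integral_setU//=.
- congr integral; apply/seteqP; split => x /=; rewrite !in_itv/=.
    move=> /andP[rx xt]; have [xs|sx] := leP x s; [left|right]; rewrite ?rx//.
  case=> /andP[H1 H2]; rewrite ?H1 ?H2 ?andbT/=; first exact: le_trans st.
  by rewrite (le_trans rs)// ltW.
- exact: measurable_funTS.
- apply/disj_setPRL => x /=; rewrite !in_itv/= => /andP[sx _] /andP[_].
  by rewrite leNgt sx.
Qed.

(** Continuous induction: let m be the supremum of the t with P a t. The local property at m joins a
    point just before m to m and, if m < b, to a point beyond it, which is a contradiction. *)
Lemma segment_chain (P : R -> R -> Prop) a b : a <= b ->
  (forall r s t, a <= r -> r <= s -> s <= t -> t <= b -> P r s -> P s t -> P r t) ->
  (forall x, a <= x <= b -> exists2 e, 0 < e & forall s t,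
     a <= s -> s <= x -> x <= t -> t <= b -> x - s < e -> t - x < e -> P s t) ->
  P a b.
Proof.
move=> ab Ptr Ploc; pose S := [set t | a <= t <= b /\ P a t].
have Sa : S a.
  split; first by rewrite lexx.
  have [|e e0] := Ploc a; first by rewrite lexx.
  by apply => //; rewrite subrr.
have supS : has_sup S by split; [exists a|exists b => t -[/andP[]]].
have am : a <= sup S by exact: ub_le_sup supS.2 _ Sa.
have mb : sup S <= b by apply: ge_sup supS.1 _ => t -[/andP[]].
have [|e e0 He] := Ploc (sup S); first by rewrite am.
have [s Ss sm] := sup_adherent e0 supS.
have sS : s <= sup S by exact: ub_le_sup supS.2 _ Ss.
have [/andP[as_ sb] Ps] := Ss.
have H t : sup S <= t -> t <= b -> t - sup S < e -> P a t.
  move=> mt tb te; apply: (Ptr a s t) => //; first exact: le_trans mt.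
  by apply: He => //; lra.
have := mb; rewrite le_eqVlt => /predU1P[mb'|ltmb].
  by apply: H; rewrite ?mb' ?subrr.
pose t := Num.min b (sup S + e / 2).
have mt : sup S < t by rewrite /t lt_min ltmb ltrDl divr_gt0.
have tb : t <= b by rewrite /t ge_min lexx.
have te : t - sup S < e.
  have : t <= sup S + e / 2 by rewrite /t ge_min lexx orbT.
  by lra.
have : S t by split; [rewrite tb andbT; lra|exact: H (ltW mt) tb te].
by move=> /(ub_le_sup supS.2); rewrite leNgt mt.
Qed.

Lemma closed_itv_min (K : set R) s t : closed K -> (K `&` `[s, t]) !=set0 ->
  exists p, [/\ K p, s <= p <= t & forall x, K x -> s <= x < p -> False].
Proof.
move=> cK [z [Kz]]; rewrite /= in_itv/= => /andP[sz zt].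
pose S := [set - x | x in K `&` `[s, t]].
have S0 : S !=set0 by exists (- z); exists z => //; split => //=; rewrite in_itv/= sz.
have Sub : has_ubound S.
  by exists (- s) => _ [x [_ +] <-] /=; rewrite ?in_itv/= lerN2 => /andP[].
have cS : closed [set x | K (- x) /\ `[s, t]%classic (- x)].
  have -> : [set x | K (- x) /\ `[s, t]%classic (- x)] = -%R @^-1` (K `&` `[s, t]) by [].
  apply: closed_comp; first by move=> x _; exact: opp_continuous.
  by apply: closedI => //; exact: itv_closed.
have SE : S = [set x | K (- x) /\ `[s, t]%classic (- x)].
  apply/seteqP; split => [_ [x Hx <-]|x Hx]; first by rewrite /= opprK.
  by exists (- x) => //; rewrite opprK.
have Sm : S (sup S).
  by rewrite {1}SE; apply: cS; rewrite -SE; exact: closure_sup.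
move: Sm; rewrite {1}SE => -[Kp]; rewrite /= in_itv/= => pst.
exists (- sup S); split => // x Kx /andP[sx xp].
have : S (- x) by exists x => //; split => //=; rewrite in_itv/= sx; case/andP: pst; lra.
by move=> /(ub_le_sup Sub); lra.
Qed.

Lemma closed_itv_max (K : set R) s t : closed K -> (K `&` `[s, t]) !=set0 ->
  exists p, [/\ K p, s <= p <= t & forall x, K x -> p < x <= t -> False].
Proof.
move=> cK [z [Kz]]; rewrite /= in_itv/= => /andP[sz zt].
have cS : closed (-%R @^-1` K) by apply: closed_comp => // x _; exact: opp_continuous.
have [|p [Kp pst H]] := @closed_itv_min _ (- t) (- s) cS.
  by exists (- z); split => /=; rewrite ?opprK// in_itv/= !lerN2 sz zt.
exists (- p); split => //; first by move: pst => /andP[]; lra.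
move=> x Kx /andP[px xt]; apply: (H (- x)); rewrite /= ?opprK//.
by lra.
Qed.

(** By [segment_chain] only short segments around a point x matter. If x is not in K, the segment
    avoids K and g suffices. If x is in K, the segment lies in V; cut it at the first and last
    points p and r of K. F and H agree at p and r, so g' controls F between them, and the outer
    pieces have no point of K in their interior. *)
Lemma gluing_closed (F H : R -> R) (g g' : R -> \bar R) a b (K V : set R) :
  a <= b -> closed K -> open V -> K `<=` V ->
  measurable_fun setT g -> measurable_fun setT g' ->
  (forall x, (0 <= g x)%E) -> (forall x, (0 <= g' x)%E) ->
  (forall s t, a <= s -> s <= t -> t <= b ->
     (`|F t - F s|%:E <= \int[mu]_(x in `[s, t]) g x)%E) ->
  (forall s t, a <= s -> s <= t -> t <= b ->
     (`|H t - H s|%:E <= \int[mu]_(x in `[s, t]) g' x)%E) ->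
  (forall x, a <= x <= b -> K x -> F x = H x) ->
  (`|F b - F a|%:E <=
   \int[mu]_(x in `[a, b]) ((g \_ (~` K)) x + (g' \_ V) x))%E.
Proof.
move=> ab cK oV KV mg mg' g0 g'0 Fg Hg FH.
set k := fun x => ((g \_ (~` K)) x + (g' \_ V) x)%E.
have gK0 x : (0 <= (g \_ (~` K)) x)%E by apply: erestrict_ge0.
have gV0 x : (0 <= (g' \_ V) x)%E by apply: erestrict_ge0.
have k0 x : (0 <= k x)%E by rewrite /k adde_ge0.
have mk : measurable_fun setT k.
  apply: emeasurable_funD; apply/(measurable_restrictT _ _).1.
  - by apply: measurableC; exact: closed_measurable.
  - exact: measurable_funTS.
  - exact: open_measurable.
  - exact: measurable_funTS.
pose P s t := (`|F t - F s|%:E <= \int[mu]_(x in `[s, t]) k x)%E.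
have Ptr r s t : a <= r -> r <= s -> s <= t -> t <= b -> P r s -> P s t -> P r t.
  move=> _ rs st _ Prs Pst; rewrite /P (integral_itvD mk k0 rs st).
  apply: le_trans (leeD Prs Pst); rewrite -EFinD lee_fin.
  by have := ler_distD (F s) (F t) (F r); lra.
have Pout s t : a <= s -> s <= t -> t <= b -> (forall x, K x -> s < x < t -> False) -> P s t.
  move=> as_ st tb Kst; apply: (le_trans (Fg _ _ as_ st tb)).
  (* The endpoints may belong to K, so both integrals are passed to the open interval. *)
  rewrite integral_itv_bndoo; last exact: measurable_funTS.
  rewrite [leRHS]integral_itv_bndoo; last exact: measurable_funTS.
  apply: ge0_le_integral => //=.
  - exact: measurable_funTS.
  - exact: measurable_funTS.
  - move=> x; rewrite in_itv/= => xst; rewrite /k patchE mem_set ?leeDl//.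
    by move=> Kx; exact: Kst xst.
have Pin s t : a <= s -> s <= t -> t <= b -> K s -> K t ->
    (forall x, s <= x <= t -> V x) -> P s t.
  move=> as_ st tb Ks Kt Vst; rewrite /P !FH ?as_ ?(le_trans as_)//=;
    last by rewrite (le_trans st).
  apply: (le_trans (Hg _ _ as_ st tb)).
  apply: ge0_le_integral => //=.
  - exact: measurable_funTS.
  - exact: measurable_funTS.
  - move=> x; rewrite in_itv/= => xst; rewrite /k [X in (_ + X)%E]patchE mem_set ?leeDr//.
    exact: Vst.
apply: (segment_chain ab Ptr) => x /andP[ax xb].
have [Kx|nKx] := pselect (K x); last first.
  have oK : open (~` K) by exact: closed_openC.
  have /nbhs_ballP[e e0 He] := open_nbhs_nbhs (conj oK nKx).
  exists e => // s t as_ sx xt tb xs tx; apply: Pout => //; first exact: le_trans xt.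
  move=> y Ky /andP[sy yt]; apply: (He y) Ky.
  by rewrite /ball/= ltr_norml; lra.
have /nbhs_ballP[e e0 He] := open_nbhs_nbhs (conj oV (KV _ Kx)).
exists e => // s t as_ sx xt tb xs tx.
have Vst y : s <= y <= t -> V y.
  by move=> /andP[sy yt]; apply: He; rewrite /ball/= ltr_norml; lra.
have Kst : (K `&` `[s, t]) !=set0 by exists x; split => //=; rewrite in_itv/= sx.
have [p [Kp /andP[sp pt] pmin]] := closed_itv_min cK Kst.
have [r [Kr /andP[sr rt] rmax]] := closed_itv_max cK Kst.
have px : p <= x by rewrite leNgt; apply/negP => xp; apply: (pmin x) => //; rewrite sx.
have xr : x <= r by rewrite leNgt; apply/negP => rx; apply: (rmax x) => //; rewrite rx.
have ap := le_trans as_ sp; have pr := le_trans px xr; have rb := le_trans rt tb.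
apply: (Ptr s p t) => //.
  apply: Pout => // [|y Ky /andP[sy yp]]; first exact: le_trans rb.
  by apply: (pmin y Ky); rewrite (ltW sy).
apply: (Ptr p r t) => //.
  apply: Pin => // y /andP[py yr]; apply: Vst.
  by rewrite (le_trans sp)//= (le_trans yr).
apply: Pout => // [|y Ky /andP[ry yt]]; first exact: le_trans pr.
by apply: (rmax y Ky); rewrite (ltW yt) ry.
Qed.

(* Squeeze K `<=` E `<=` V with K compact and V open, V `\` K being so small that
   the closed case is off by an arbitrarily small error; no differentiation of
   F along E is needed. *)
Lemma gluing_measurable (F H : R -> R) (g g' : R -> \bar R) a b (E : set R) :
  a <= b -> measurable E ->
  measurable_fun setT g -> measurable_fun setT g' ->
  (forall x, (0 <= g x)%E) -> (forall x, (0 <= g' x)%E) ->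
  (\int[mu]_(x in `[a, b]) g x < +oo)%E ->
  (\int[mu]_(x in `[a, b]) g' x < +oo)%E ->
  (forall s t, a <= s -> s <= t -> t <= b ->
     (`|F t - F s|%:E <= \int[mu]_(x in `[s, t]) g x)%E) ->
  (forall s t, a <= s -> s <= t -> t <= b ->
     (`|H t - H s|%:E <= \int[mu]_(x in `[s, t]) g' x)%E) ->
  (forall x, a <= x <= b -> E x -> F x = H x) ->
  (`|F b - F a|%:E <=
   \int[mu]_(x in `[a, b]) ((g \_ (~` E)) x + (g' \_ E) x))%E.
Proof.
move=> ab mE mg mg' g0 g'0 goo g'oo Fg Hg FH.
have mI : measurable `[a, b] by exact: measurable_itv.
apply/lee_addgt0Pr => e e0; have e20 : 0 < e / 2 by rewrite divr_gt0.
have [r r0 rP] := @integral_small _ _ _ mu _ _ _ mI (measurable_funTS mg) g0 goo e20.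
have [r' r'0 r'P] := @integral_small _ _ _ mu _ _ _ mI (measurable_funTS mg') g'0 g'oo e20.
(* Cutting E down to [a, b] provides the finite measure required by inner and outer regularity. *)
pose E0 := E `&` `[a, b].
have mE0 : measurable E0 by exact: measurableI.
have E0oo : (mu E0 < +oo)%E.
  apply: (@le_lt_trans _ _ (mu `[a, b])); first by apply: le_measure; rewrite ?inE//;
    exact: subIsetr.
  by rewrite lebesgue_measure_itv /=; case: ifP => _; rewrite -?EFinD ltry.
have [K [cK KE Ksmall]] := lebesgue_regularity_inner mE0 E0oo r0.
have [V [oV EV Vsmall]] := lebesgue_regularity_outer mE0 E0oo r'0.
have clK : closed K by apply: compact_closed cK; exact: Rhausdorff.
have mK : measurable K by exact: closed_measurable.
have mV : measurable V by exact: open_measurable.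
apply: (le_trans (gluing_closed ab clK oV (subset_trans KE EV) mg mg' g0 g'0 Fg Hg _)).
  by move=> x xab Kx; apply: FH => //; have [] := KE _ Kx.
have res (h : R -> \bar R) A : (forall x, (0 <= h x)%E) -> measurable_fun setT h -> measurable A ->
    (forall x, (0 <= (h \_ A) x)%E) /\ measurable_fun setT (h \_ A).
  move=> h0 mh mA; split; first by move=> x; apply: erestrict_ge0.
  by apply/(measurable_restrictT _ _).1 => //; exact: measurable_funTS.
have [g1 mg1] := res _ _ g0 mg (measurableC mE).
have [g2 mg2] := res _ _ g'0 mg' mE.
have [g3 mg3] := res _ _ g0 mg (measurableD mE0 mK).
have [g4 mg4] := res _ _ g'0 mg' (measurableD mV mE0).
have [g5 mg5] := res _ _ g0 mg (measurableC mK).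
have [g6 mg6] := res _ _ g'0 mg' mV.
(* Within [a, b], the complement of K is covered by the complement of E and E0 minus K, and V by E
   and V minus E0. The sets E0 minus K and V minus E0 have measure below r and r', so each error
   integral is below e / 2. *)
apply: (@le_trans _ _ (\int[mu]_(x in `[a, b])
  (((g \_ (~` E)) x + (g' \_ E) x) +
   ((g \_ (E0 `\` K)) x + (g' \_ (V `\` E0)) x)))%E).
  apply: ge0_le_integral => //=.
  - by move=> x _; rewrite adde_ge0.
  - by apply: measurable_funTS; exact: emeasurable_funD.
  - by apply: measurable_funTS; apply: emeasurable_funD; exact: emeasurable_funD.
  - move=> x; rewrite in_itv/= => xab; rewrite addeACA; apply: leeD.
      have [xK|xK] := boolP (x \in K).
        by rewrite patchE ifN ?adde_ge0// in_setC xK.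
      have [xE|xE] := boolP (x \in E).
        rewrite [leLHS]patchE in_setC xK [X in (_ <= _ + X)%E]patchE ifT ?leeDr//.
        by rewrite in_setD xK /E0 in_setI xE mem_set//= in_itv.
      by rewrite [leLHS]patchE in_setC xK [X in (_ <= X + _)%E]patchE in_setC xE leeDl.
    have [xV|xV] := boolP (x \in V); last by rewrite patchE (negbTE xV) adde_ge0.
    have [xE|xE] := boolP (x \in E).
      by rewrite [leLHS]patchE xV [X in (_ <= X + _)%E]patchE xE leeDl.
    rewrite [leLHS]patchE xV [X in (_ <= _ + X)%E]patchE ifT ?leeDr//.
    by rewrite in_setD xV /E0 in_setI (negbTE xE).
rewrite ge0_integralD//; first last.
- by apply: measurable_funTS; exact: emeasurable_funD.
- by move=> x _; rewrite adde_ge0.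
- by apply: measurable_funTS; exact: emeasurable_funD.
- by move=> x _; rewrite adde_ge0.
rewrite leeD2l// ge0_integralD//; try exact: measurable_funTS.
rewrite (splitr e) EFinD -!integral_mkcondr; apply: leeD; apply: ltW.
  by apply: rP => //; exact: measurableD.
by apply: r'P => //; exact: measurableD.
Qed.

End interval_integral.

(** * Modulus of curve families *)

Section curve_integrals.
Context {R : realType} {X : pointedMetricType R}.
Local Notation lam := (@lebesgue_measure R).

Lemma nonneg_borel_restrict (g : X -> \bar R) (B : set X) : borel B ->
  nonneg_borel_fun g -> nonneg_borel_fun (g \_ B).
Proof.
move=> bB [mg g0]; split; last by move=> x; apply: erestrict_ge0.
have mB : measurable (B : set (borel_type X)) by exact: bB.
apply: (@measurable_restrictT _ _ (borel_type X) _ _ _ mB).1.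
exact: measurable_funTS.
Qed.

Lemma nonneg_borelD (g h : X -> \bar R) :
  nonneg_borel_fun g -> nonneg_borel_fun h ->
  nonneg_borel_fun (fun x => g x + h x)%E.
Proof.
move=> [mg g0] [mh h0]; split; last by move=> x; rewrite adde_ge0.
exact: emeasurable_funD.
Qed.

Lemma lip_measurable (p : R -> X) : (forall s t, mdist (p s) (p t) <= `|s - t|) ->
  measurable_fun [set: R] (p : R -> borel_type X).
Proof.
move=> lp; apply: (@measurability _ _ _ (borel_type X) _ _ (@open X)) => //.
move=> _ [U oU <-]; rewrite setTI; apply: open_measurable.
apply: open_comp oU => x _.
apply/metricType_numDomainType.cvgrPdist_lt => e e0; apply/nbhs_ballP.
exists e => //= y; rewrite /ball/= => xy.
exact: le_lt_trans xy.
Qed.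

Lemma measurable_along c (g : X -> \bar R) : rectifiable c -> nonneg_borel_fun g ->
  measurable_fun [set: R] (g \o arc_length_ext c).
Proof.
move=> rc [mg _]; apply: (@measurableT_comp _ _ _ _ _ _ (g : borel_type X -> \bar R)) => //.
by apply: lip_measurable => s t; exact: arc_length_ext_lip.
Qed.

Lemma le_line_integral c (g h : X -> \bar R) : rectifiable c ->
  nonneg_borel_fun g -> nonneg_borel_fun h -> (forall x, (g x <= h x)%E) ->
  (line_integral g c <= line_integral h c)%E.
Proof.
move=> rc bg bh gh; rewrite !line_integralE; apply: ge0_le_integral => //=.
- by move=> x _; exact: bg.2.
- by apply: measurable_funTS; exact: (measurable_along rc bg).
- by apply: measurable_funTS; exact: (measurable_along rc bh).
Qed.

(** Translation invariance of Lebesgue measure, by uniqueness: its push-forward under the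
    translation has the same values on the intervals ]a, b]. *)
Lemma integral_translate (h : R -> \bar R) (s t : R) :
  measurable_fun [set: R] h -> (forall x, (0 <= h x)%E) ->
  (\int[lam]_(x in `[0%R, (t - s)%R]) h (s + x)%R = \int[lam]_(x in `[s, t]) h x)%E.
Proof.
move=> mh h0.
have ms : measurable_fun [set: measurableTypeR R]
  (+%R s : measurableTypeR R -> measurableTypeR R) by exact: measurable_funD.
pose tr : {mfun measurableTypeR R >-> measurableTypeR R} :=
  HB.pack (+%R s : measurableTypeR R -> measurableTypeR R) (isMeasurableFun.Build _ _ _ _ _ ms).
rewrite [RHS](eq_measure_integral (pushforward lam tr)); last first.
  move=> A mA _; apply: lebesgue_measure_unique mA => _ [[a b] _ <-].
  rewrite -[RHS]/(lam (+%R s @^-1` `]a, b]%classic)).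
  have -> : +%R s @^-1` `]a, b]%classic = `]a - s, b - s]%classic.
    by apply/seteqP; split => x /=; rewrite !in_itv/= => /andP[? ?]; apply/andP; split; lra.
  rewrite !lebesgue_measure_itv /= !lte_fin ltrD2r.
  by case: ifP => // _; rewrite -!EFinD; congr EFin; lra.
rewrite ge0_integral_pushforward//=; last exact: measurable_funTS.
congr integral; apply/seteqP; split => x /=; rewrite !in_itv/= => /andP[? ?];
  by apply/andP; split; lra.
Qed.

(** One subcurve serves for all g at once, which is what [modulus0_minorize] asks for. *)
Lemma subcurve_integral c s t : rectifiable c ->
  0 <= s -> s <= t -> t <= fine (curve_length c) ->
  exists c' : curve X, [/\ rectifiable c',
    c' (cstart c') = arc_length_ext c s, c' (cend c') = arc_length_ext c t &
    forall g, nonneg_borel_fun g ->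
      line_integral g c' =
      (\int[lam]_(x in `[s, t]) g (arc_length_ext c x))%E].
Proof.
move=> rc s0 st tl; have [c' [rc' cs ct lc' cE]] := subcurveP rc s0 st tl.
exists c'; split => // g bg; rewrite line_integralE lc'.
rewrite -(@integral_translate (g \o arc_length_ext c)); last 2 first.
- exact: measurable_along.
- by move=> x; exact: bg.2.
by apply: eq_integral => x; rewrite inE/= in_itv/= => xts; rewrite cE.
Qed.

End curve_integrals.

Section modulus_theory.
Context {R : realType} {X : pointedMetricType R}.
Variables (mu : {outer_measure set X -> \bar R}) (q : R).
Hypothesis bmu : @borel R X `<=` mu.-caratheodory.
Hypothesis q0 : 0 < q.
Local Open Scope ereal_scope.
Local Notation cara := (cara_measure mu).
Implicit Types (g h : X -> \bar R) (Gamma : set (curve X)).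

Lemma measurable_cara g : nonneg_borel_fun g ->
  measurable_fun [set: caratheodory_type mu] (g : caratheodory_type mu -> \bar R).
Proof.
move=> [mg _] _ B mB; rewrite setTI; apply: bmu.
by have := mg measurableT B mB; rewrite setTI.
Qed.

Lemma measurable_caraX g : nonneg_borel_fun g ->
  measurable_fun [set: caratheodory_type mu]
    ((fun x => g x `^ q) : caratheodory_type mu -> \bar R).
Proof.
move=> bg; apply: (measurableT_comp (measurable_poweR q)); exact: measurable_cara.
Qed.

Lemma q_energy_ge0 A g : 0 <= q_energy mu q A g.
Proof. by apply: integral_ge0 => x _; exact: poweR_ge0. Qed.

Lemma le_poweRq (x y : \bar R) : 0 <= x -> x <= y -> x `^ q <= y `^ q.
Proof.
move=> x0 xy; apply: (gt0_ler_poweR (ltW q0)) => //; rewrite in_itv/= leey andbT//.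
exact: le_trans xy.
Qed.

Lemma poweRqK (x : \bar R) : 0 <= x -> (x `^ q) `^ q^-1 = x.
Proof. by move=> x0; rewrite -poweRrM divff ?gt_eqF// poweRe1. Qed.

Lemma poweRq_le_inv (x y : \bar R) : 0 <= x -> 0 <= y -> x `^ q <= y `^ q -> x <= y.
Proof.
move=> x0 y0 xy; rewrite -(poweRqK x0) -(poweRqK y0).
by apply: gt0_ler_poweR; rewrite ?invr_ge0 ?(ltW q0)// ?in_itv/= ?leey ?andbT ?poweR_ge0.
Qed.

Lemma poweRqVK (x : \bar R) : 0 <= x -> (x `^ q^-1) `^ q = x.
Proof. by move=> x0; rewrite -poweRrM mulVf ?gt_eqF// poweRe1. Qed.

Lemma le_q_energy g h : nonneg_borel_fun g -> nonneg_borel_fun h ->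
  (forall x, g x <= h x) -> q_energy mu q setT g <= q_energy mu q setT h.
Proof.
move=> bg bh gh; apply: ge0_le_integral => //.
- by move=> x _; exact: poweR_ge0.
- exact: measurable_caraX.
- exact: measurable_caraX.
- by move=> x _; apply: le_poweRq; [exact: bg.2|exact: gh].
Qed.

Lemma modulus_ge0 Gamma : 0 <= modulus mu q Gamma.
Proof. by apply: le_ereal_inf_tmp => _ [g _ <-]; exact: q_energy_ge0. Qed.

Lemma modulus0P Gamma : modulus mu q Gamma = 0 <->
  forall e : R, (0 < e)%R -> exists2 g, admissible Gamma g & q_energy mu q setT g < e%:E.
Proof.
split=> [m0 e e0|H].
  have : modulus mu q Gamma < e%:E by rewrite m0 lte_fin.
  by move=> /ereal_inf_lt[_ [g ag <-] ge]; exists g.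
apply/le_anti; rewrite modulus_ge0 andbT; apply/lee_addgt0Pr => e e0.
rewrite add0e; have [g ag ge] := H e e0.
by apply: le_trans (ltW ge); apply: ereal_inf_lbound; exists g.
Qed.

Lemma modulus0_sub Gamma Gamma' : Gamma `<=` Gamma' ->
  modulus mu q Gamma' = 0 -> modulus mu q Gamma = 0.
Proof.
move=> GG /modulus0P m0; apply/modulus0P => e /m0[g [bg ag] ge].
by exists g => //; split => // c /GG; exact: ag.
Qed.

(** The q-th root of the sum of the g_n ^ q dominates each g_n, hence is admissible for the union,
    and its q-energy is the sum of the q-energies of the g_n. *)
Lemma modulus0_bigcup (Gamma_ : (set (curve X))^nat) :
  (forall n, modulus mu q (Gamma_ n) = 0) -> modulus mu q (\bigcup_n Gamma_ n) = 0.
Proof.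
move=> m0; apply/modulus0P => e e0.
(* The additional factor 1/2 makes the total at most e / 2, so that the final inequality is
   strict. *)
pose e_ n : R := (e / 2 / (2 ^ n.+1)%:R)%R.
have e_0 n : (0 < e_ n)%R by rewrite !divr_gt0// ltr0n expn_gt0.
have /choice[g gP] n : exists g, admissible (Gamma_ n) g /\ q_energy mu q setT g < (e_ n)%:E.
  by have /modulus0P/(_ _ (e_0 n))[g ag ge] := m0 n; exists g.
have bg n : nonneg_borel_fun (g n) by have [[]] := gP n.
pose S x := \sum_(n <oo) (g n x `^ q); pose h x := S x `^ q^-1.
have S0 x : 0 <= S x by apply: nneseries_ge0 => n _ _; exact: poweR_ge0.
have bh : nonneg_borel_fun h.
  split; last by move=> x; exact: poweR_ge0.
  apply: (measurableT_comp (measurable_poweR q^-1)).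
  apply: ge0_emeasurable_sum => [n x _ _|n _]; first exact: poweR_ge0.
  by apply: (measurableT_comp (measurable_poweR q)); exact: (bg n).1.
have gh n x : g n x <= h x.
  apply: poweRq_le_inv; [exact: (bg n).2|exact: poweR_ge0|rewrite poweRqVK//].
  rewrite /S (@nneseriesD1 _ _ n)//; last by move=> *; exact: poweR_ge0.
  by rewrite leeDl// nneseries_ge0// => *; exact: poweR_ge0.
exists h; first split => // c [n _ Gc] rc.
  apply: (@le_trans _ _ (line_integral (g n) c)); first exact: (gP n).1.2.
  exact: le_line_integral.
apply: (@le_lt_trans _ _ (e / 2)%:E); last first.
  by rewrite lte_fin ltr_pdivrMr// ltr_pMr// ltr1n.
rewrite /q_energy; under eq_integral => x _ do rewrite poweRqVK//.
rewrite integral_nneseries//; last 2 first.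
- by move=> n; exact: measurable_caraX.
- by move=> n x _; exact: poweR_ge0.
apply: (@le_trans _ _ (\sum_(n <oo) (e_ n)%:E)).
  apply: lee_nneseries => n; first by move=> _ _; exact: q_energy_ge0.
  by move=> _; exact/ltW/(gP n).2.
by apply: epsilon_trick0; rewrite divr_ge0// ltW.
Qed.

Lemma modulus0U Gamma Gamma' : modulus mu q Gamma = 0 -> modulus mu q Gamma' = 0 ->
  modulus mu q (Gamma `|` Gamma') = 0.
Proof.
move=> m m'; rewrite -bigcup2E; apply: modulus0_bigcup => -[//|[//|n]].
apply: modulus0_sub m; exact: sub0set.
Qed.

(** A function admissible for [Gamma] is also admissible for the larger curves. The typical case is
    the family of all curves that have a subcurve in a given null family. *)
Lemma modulus0_minorize Gamma : modulus mu q Gamma = 0 ->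
  modulus mu q [set c | exists c', [/\ Gamma c', rectifiable c' &
    forall g, nonneg_borel_fun g -> line_integral g c' <= line_integral g c]] = 0.
Proof.
move=> /modulus0P m0; apply/modulus0P => e /m0[g [bg ag] ge].
exists g => //; split => // c [c' [Gc' rc' H]] rc.
by apply: le_trans (H g bg); exact: ag.
Qed.

Lemma nonneg_borelZ (k : R) g : (0 <= k)%R -> nonneg_borel_fun g ->
  nonneg_borel_fun (fun x => k%:E * g x).
Proof.
move=> k0 [mg g0]; split; last by move=> x; rewrite mule_ge0.
exact: measurable_funeM.
Qed.

(** Every positive multiple k g is admissible, because k times infinity is infinity, and its energy
    k ^ q E becomes arbitrarily small. *)
Lemma modulus0_infinite g : nonneg_borel_fun g -> q_energy mu q setT g < +oo ->
  modulus mu q [set c | line_integral g c = +oo] = 0.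
Proof.
move=> bg goo; apply/modulus0P => e e0.
have gfin : q_energy mu q setT g \is a fin_num by rewrite ge0_fin_numE// q_energy_ge0.
set E := fine (q_energy mu q setT g).
have E0 : (0 <= E)%R by rewrite fine_ge0// q_energy_ge0.
(* Dividing by E + 1 covers the case E = 0 and makes the energy of k g strictly smaller than e. *)
have eE0 : (0 < e / (E + 1))%R by rewrite divr_gt0// ltr_wpDl.
pose k : R := ((e / (E + 1)) `^ q^-1)%R.
have k0 : (0 < k)%R by rewrite powR_gt0.
have kq : (k `^ q = e / (E + 1))%R.
  by rewrite -powRrM mulVf ?gt_eqF// powRr1// ltW.
have bkg := nonneg_borelZ (ltW k0) bg.
exists (fun x => k%:E * g x).
  split => // c coo rc.
  have -> : line_integral (fun x => k%:E * g x) c = k%:E * line_integral g c.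
    rewrite !line_integralE ge0_integralZl//.
    - by apply: measurable_funTS; exact: (measurable_along rc bg).
    - by move=> x _; exact: bg.2.
    - by rewrite lee_fin ltW.
  by rewrite coo gt0_muley// ?lte_fin// leey.
rewrite /q_energy; under eq_integral => x _ do
  rewrite poweRM ?lee_fin ?(ltW k0) ?bg.2// poweR_EFin kq.
rewrite ge0_integralZl//; last 3 first.
- exact: measurable_caraX.
- by move=> x _; exact: poweR_ge0.
- by rewrite lee_fin ltW.
rewrite -[X in _ * X](fineK gfin) -EFinM lte_fin -/E.
by rewrite mulrAC ltr_pdivrMr ?ltr_wpDl// ltr_pM2l// ltrDl.
Qed.

End modulus_theory.

(** * Weak upper gradients *)

Section ae_monotone.
Context d (T : measurableType d) (R : realType) (m : {measure set T -> \bar R}).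
Local Open Scope ereal_scope.

Lemma ae_mono (P Q : T -> Prop) : (forall x, P x -> Q x) ->
  {ae m, forall x, P x} -> {ae m, forall x, Q x}.
Proof. by move=> PQ; apply: filterS. Qed.

Lemma ae_mono2 (P P' Q : T -> Prop) : (forall x, P x -> P' x -> Q x) ->
  {ae m, forall x, P x} -> {ae m, forall x, P' x} -> {ae m, forall x, Q x}.
Proof. by move=> PQ; apply: filterS2. Qed.

(** The difference f2 - f1 is nonnegative with integral 0, hence vanishes almost everywhere. It is
    formed on the set D where f2 is finite, whose complement is null. *)
Lemma ge0_le_integral_ae_eq (f1 f2 : T -> \bar R) :
  measurable_fun setT f1 -> measurable_fun setT f2 ->
  (forall x, 0 <= f1 x) -> (forall x, f1 x <= f2 x) ->
  \int[m]_x f2 x < +oo -> \int[m]_x f2 x <= \int[m]_x f1 x ->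
  {ae m, forall x, f2 x <= f1 x}.
Proof.
move=> mf1 mf2 f10 f12 f2oo int21.
have f20 x : 0 <= f2 x by exact: le_trans (f12 x).
pose D := [set x | f2 x < +oo].
have DP x : D x -> f2 x < +oo by [].
have mD : measurable D.
  rewrite -[D]setTI; exact: emeasurable_fun_infty_o.
have f1oo : \int[m]_x f1 x < +oo.
  by apply: le_lt_trans f2oo; exact: ge0_le_integral.
have i2 : m.-integrable setT f2.
  by apply/integrableP; split => //; under eq_integral do rewrite gee0_abs//.
have aeD : {ae m, forall x, D x}.
  apply: filterS (integrable_ae measurableT i2) => x /(_ I).
  by rewrite /D/= ge0_fin_numE.
have D0 : m (~` D) = 0.
  case: aeD => N [mN N0 DN]; apply: (@subset_measure0 _ _ _ m _ N) => //.
  exact: measurableC.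
have toD f : measurable_fun setT f -> (forall x, 0 <= f x) ->
    \int[m]_x f x = \int[m]_(x in D) f x.
  move=> mf f0; rewrite (ge0_negligible_integral _ _ _ _ D0)//; last exact: measurableC.
  by rewrite setTD setCK.
have f1D : \int[m]_(x in D) f1 x \is a fin_num.
  by rewrite -toD// ge0_fin_numE// integral_ge0.
have B0 x : D x -> 0 <= f2 x - f1 x.
  by move=> Dx; rewrite sube_ge0 ?f12//; apply/orP; left;
    rewrite ge0_fin_numE//; exact: le_lt_trans (f12 x) (DP _ Dx).
have mB : measurable_fun D (fun x => f2 x - f1 x).
  by apply: emeasurable_funB; exact: measurable_funTS.
have D2 : \int[m]_(x in D) f2 x = \int[m]_(x in D) f1 x + \int[m]_(x in D) (f2 x - f1 x).
  rewrite -ge0_integralD//; last exact: measurable_funTS.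
  apply: eq_integral => x; rewrite inE => Dx; rewrite addeC subeK//.
  by rewrite ge0_fin_numE//; exact: le_lt_trans (f12 x) (DP _ Dx).
have B_0 : \int[m]_(x in D) (f2 x - f1 x) = 0.
  apply/le_anti; rewrite integral_ge0// andbT.
  by rewrite -(@leeD2lE _ (\int[m]_(x in D) f1 x))// -D2 adde0 -!toD.
have : ae_eq m D (fun x => f2 x - f1 x) (cst 0).
  apply/ae_eq_integral_abs => //; rewrite -[RHS]B_0.
  by apply: eq_integral => x; rewrite inE => Dx; rewrite gee0_abs// B0.
apply: filterS2 aeD => x Dx /(_ Dx) /= e0.
have f1x : f1 x \is a fin_num by rewrite ge0_fin_numE//; exact: le_lt_trans (f12 x) (DP _ Dx).
by rewrite -sube_le0 e0.
Qed.

End ae_monotone.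

Section weak_upper_gradient_theory.
Context {R : realType} {X : pointedMetricType R}.
Variables (mu : {outer_measure set X -> \bar R}) (q : R).
Hypothesis bmu : @borel R X `<=` mu.-caratheodory.
Hypothesis q0 : 0 < q.
Local Open Scope ereal_scope.
Local Notation cara := (cara_measure mu).
Local Notation lam := (@lebesgue_measure R).
Local Notation energy := (q_energy mu q setT).
Implicit Types (u h : X -> R) (g : X -> \bar R) (c : curve X).

(** The upper gradient inequality on all subcurves, together with integrability of g along the
    curve: these are the one-dimensional hypotheses of [gluing_measurable]. *)
Definition good_curve u g c := line_integral g c < +oo /\
  forall s t, (0 <= s)%R -> (s <= t)%R -> (t <= fine (curve_length c))%R ->
    `|u (arc_length_ext c t) - u (arc_length_ext c s)|%:E <=
    \int[lam]_(x in `[s, t]) g (arc_length_ext c x).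

Lemma good_curve_ineq u g c : rectifiable c -> good_curve u g c ->
  upper_gradient_ineq u g c.
Proof.
move=> rc [_ /(_ (0 : R)%R _ (lexx _) (curve_length_ge0 c) (lexx _))].
by rewrite /upper_gradient_ineq line_integralE arc_length_ext_start// arc_length_ext_end.
Qed.

(** A curve that is not good either has an infinite integral of g or contains a subcurve violating
    the inequality; both families are null, by [modulus0_infinite] and [modulus0_minorize]. *)
Lemma modulus0_not_good u g : weak_upper_gradient mu q u g -> energy g < +oo ->
  modulus mu q [set c | rectifiable c /\ ~ good_curve u g c] = 0.
Proof.
move=> [bg m0] goo.
apply: modulus0_sub (modulus0U bmu q0 (modulus0_infinite bmu q0 bg goo)
  (modulus0_minorize m0)) => c [rc ng] /=.
have [loo|loo] := eqVneq (line_integral g c) +oo; [by left|right].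
apply: contrapT => H; apply: ng; split; first by rewrite ltey.
move=> s t s0 st tl; have [c' [rc' cs ct cg]] := subcurve_integral rc s0 st tl.
apply: contrapT => bad; apply: H; exists c'; split => //.
- by split => //; rewrite /upper_gradient_ineq cs ct cg.
- move=> h [mh h0]; rewrite cg// line_integralE; apply: ge0_subset_integral => //=.
  + by apply: measurable_funTS; exact: (measurable_along rc).
  + by move=> x; rewrite /= !in_itv/= => /andP[sx xt]; rewrite (le_trans s0)// (le_trans xt).
Qed.

Lemma weak_upper_gradient_of_ae u g (Gamma : set (curve X)) : nonneg_borel_fun g ->
  modulus mu q Gamma = 0 ->
  (forall c, rectifiable c -> ~ Gamma c -> upper_gradient_ineq u g c) ->
  weak_upper_gradient mu q u g.
Proof.
move=> bg m0 H; split => //; apply: modulus0_sub m0 => c [rc nc].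
by apply: contrapT => /(H c rc).
Qed.

Lemma upper_gradient_weak u g : upper_gradient u g -> weak_upper_gradient mu q u g.
Proof.
move=> [bg ug]; apply: (@weak_upper_gradient_of_ae _ _ set0) => //; last first.
  by move=> c rc _; exact: ug.
apply/modulus0P => e e0; exists (cst 0).
  by split; [split; [exact: measurable_cst|move=> x; exact: lexx]|move=> c []].
rewrite /q_energy (eq_integral (cst 0)) ?integral0 ?lte_fin// => x _.
by rewrite /cst poweR0r// gt_eqF.
Qed.

(** Upper gradient inequalities see a function only through the absolute values of its differences.
    This is used for h + c and - h + c. *)
Lemma weak_upper_gradient_osc u h g :
  (forall x y, `|u x - u y| = `|h x - h y|)%R ->
  weak_upper_gradient mu q h g -> weak_upper_gradient mu q u g.
Proof.
move=> uh [bg m0]; split => //; rewrite -[RHS]m0; congr modulus.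
by apply/seteqP; split => c [rc nc]; split => //; move: nc; rewrite /upper_gradient_ineq uh.
Qed.

(** Almost every curve is good for both pairs; along such a curve, arc length turns the claim into
    [gluing_measurable] for the preimage of B. *)
Lemma weak_upper_gradient_glue u h g g' (B : set X) : borel B ->
  (forall x, B x -> u x = h x) ->
  weak_upper_gradient mu q u g -> energy g < +oo ->
  weak_upper_gradient mu q h g' -> energy g' < +oo ->
  weak_upper_gradient mu q u (fun x => (g \_ (~` B)) x + (g' \_ B) x).
Proof.
move=> bB uh wg goo wg' g'oo; have [bg _] := wg; have [bg' _] := wg'.
have bBC : borel (~` B) by exact: (@measurableC _ (borel_type X)).
apply: (weak_upper_gradient_of_ae _ (modulus0U bmu q0 (modulus0_not_good wg goo)
  (modulus0_not_good wg' g'oo))).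
  by apply: nonneg_borelD; exact: nonneg_borel_restrict.
move=> c rc /not_orP[/not_andP[//|/contrapT gc] /not_andP[//|/contrapT hc]].
rewrite /upper_gradient_ineq line_integralE -arc_length_ext_start// -arc_length_ext_end//.
pose p := arc_length_ext c.
have mp : measurable_fun [set: R] (p : R -> borel_type X).
  by apply: lip_measurable => s t; exact: arc_length_ext_lip.
pose E := p @^-1` B.
have mE : measurable E by rewrite -[E]setTI; exact: mp.
have rE (f : X -> \bar R) A x : ((f \o p) \_ (p @^-1` A)) x = (f \_ A) (p x).
  by rewrite !patchE; congr (if _ then _ else _); apply/idP/idP; rewrite !inE.
apply: (@le_trans _ _ (\int[lam]_(x in `[0%R, fine (curve_length c)])
    (((g \o p) \_ (~` E)) x + ((g' \o p) \_ E) x))); last first.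
  rewrite le_eqVlt; apply/orP; left; apply/eqP; apply: eq_integral => x _.
  by rewrite /E preimage_setC !rE.
apply: (@gluing_measurable R (u \o p) (h \o p)) => //.
- exact: curve_length_ge0.
- exact: measurable_along.
- exact: measurable_along.
- by move=> x; exact: bg.2.
- by move=> x; exact: bg'.2.
- by have [] := gc; rewrite line_integralE.
- by have [] := hc; rewrite line_integralE.
- by have [] := gc.
- by have [] := hc.
- by move=> x _; exact: uh.
Qed.

Lemma energy_glue g g' (B : set X) : borel B ->
  nonneg_borel_fun g -> energy g < +oo -> nonneg_borel_fun g' -> energy g' < +oo ->
  energy (fun x => (g \_ (~` B)) x + (g' \_ B) x) < +oo.
Proof.
move=> bB bg goo bg' g'oo; have bBC : borel (~` B) by exact: (@measurableC _ (borel_type X)).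
have bk : nonneg_borel_fun (fun x => (g \_ (~` B)) x + (g' \_ B) x).
  by apply: nonneg_borelD; exact: nonneg_borel_restrict.
apply: (@le_lt_trans _ _ (energy g + energy g')); last by rewrite lte_add_pinfty.
rewrite -ge0_integralD//; last 4 first.
- by move=> x _; exact: poweR_ge0.
- exact: measurable_caraX.
- by move=> x _; exact: poweR_ge0.
- exact: measurable_caraX.
apply: ge0_le_integral => //.
- by move=> x _; exact: poweR_ge0.
- exact: measurable_caraX.
- by apply: emeasurable_funD; exact: measurable_caraX.
- move=> x _; rewrite !patchE in_setC; case: (x \in B) => /=.
    by rewrite add0e leeDr// poweR_ge0.
  by rewrite adde0 leeDl// poweR_ge0.
Qed.

Definition finite_wug u g := weak_upper_gradient mu q u g /\ energy g < +oo.

(** The minimum is the gluing of g and g' along the Borel set where g' < g, both belonging to the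
    same function u. *)
Lemma finite_wug_min u g g' : finite_wug u g -> finite_wug u g' ->
  finite_wug u (fun x => mine (g x) (g' x)).
Proof.
move=> [wg goo] [wg' g'oo]; have [bg _] := wg; have [bg' _] := wg'.
pose B := [set x | g' x < g x].
have bB : borel B.
  have := @measurable_fun_lte _ (borel_type X) R setT g' g bg'.1 bg.1.
  by move=> /(_ measurableT [set true] I); rewrite setTI.
have -> : (fun x => mine (g x) (g' x)) = (fun x => (g \_ (~` B)) x + (g' \_ B) x).
  apply/funext => x; rewrite !patchE in_setC; have [xB|xB] := boolP (x \in B).
    by rewrite /= add0e min_r// ltW//; move: xB; rewrite inE.
  rewrite /= adde0 min_l//; move: xB; rewrite notin_setE /B/= => /negP.
  by rewrite -leNgt.
split; last exact: energy_glue.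
exact: (@weak_upper_gradient_glue _ u).
Qed.

(** Almost every curve is good for all the [g_ n] simultaneously. Along it, [g_ 0] is integrable and
    dominates the sequence, so the inequality passes to the limit by dominated convergence. *)
Lemma finite_wug_inf u (g_ : (X -> \bar R)^nat) : (forall n, finite_wug u (g_ n)) ->
  (forall x, {homo (g_ ^~ x) : n m / (n <= m)%N >-> m <= n}) ->
  finite_wug u (fun x => ereal_inf (range (g_ ^~ x))).
Proof.
move=> wg gni; set g := (fun x => _).
have bg_ n : nonneg_borel_fun (g_ n) by have [[]] := wg n.
have cvg_g x : g_ n x @[n --> \oo] --> g x by exact: ereal_nonincreasing_cvgn.
have bg : nonneg_borel_fun g.
  split; last by move=> x; apply: le_ereal_inf_tmp => _ [n _ <-]; exact: (bg_ n).2.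
  apply: (emeasurable_fun_cvg (g_ : (borel_type X -> \bar R)^nat)) => [n|x _].
    exact: (bg_ n).1.
  exact: cvg_g.
have gle n x : g x <= g_ n x by apply: ereal_inf_lbound; exists n.
split; last first.
  by apply: le_lt_trans (wg 0%N).2; apply: le_q_energy.
apply: (weak_upper_gradient_of_ae bg (modulus0_bigcup bmu q0
  (fun n => modulus0_not_good (wg n).1 (wg n).2))) => c rc nc.
have gc n : good_curve u (g_ n) c.
  by apply: contrapT => ngc; apply: nc; exists n.
rewrite /upper_gradient_ineq.
apply: (@cvge_ge nat \oo _ R (fun n => line_integral (g_ n) c)).
  by apply: nearW => n; exact: good_curve_ineq (gc n).
rewrite line_integralE; under eq_fun do rewrite line_integralE.
have mI : measurable `[0%R, fine (curve_length c)] by exact: measurable_itv.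
have [|||||_ _ //] := @dominated_convergence _ _ _ lam _ mI
  (fun n => g_ n \o arc_length_ext c) (g \o arc_length_ext c) (g_ 0%N \o arc_length_ext c).
- by move=> n; apply: measurable_funTS; exact: measurable_along.
- by apply: measurable_funTS; exact: measurable_along.
- by apply: aeW => x _; exact: cvg_g.
- apply/integrableP; split; first by apply: measurable_funTS; exact: measurable_along.
  under eq_integral => x _ do rewrite gee0_abs ?(bg_ 0%N).2//.
  by have [] := gc 0%N; rewrite line_integralE.
- apply: aeW => x n _ /=; rewrite gee0_abs ?(bg_ n).2//.
  exact: gni.
Qed.

(** Direct method: the running minima [G n] of an energy-minimizing sequence decrease to some g' of
    least energy. For a competitor k, the minimum of g' and k has no smaller energy than g', so it
    equals g' almost everywhere, that is, g' <= k. *)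
Lemma minimal_weak_upper_gradient_exists u g : finite_wug u g ->
  exists g', minimal_weak_upper_gradient mu q u g'.
Proof.
move=> wg; pose S := [set energy h | h in finite_wug u].
have S0 : S != set0 by apply/set0P; exists (energy g); exists g.
have [v Sv vS] := ereal_inf_seq S0.
have /choice[h hP] n : exists h : X -> \bar R, finite_wug u h /\ energy h = v n.
  by have [h wh hv] := Sv n; exists h.
pose G := fix G n := if n is n'.+1 then fun x => mine (G n' x) (h n'.+1 x) else h 0%N.
have WG n : finite_wug u (G n).
  elim: n => [|n IH]; first exact: (hP 0%N).1.
  by apply: finite_wug_min => //; exact: (hP n.+1).1.
have Gh n x : G n x <= h n x by case: n => [|n] //=; rewrite ge_min lexx orbT.
have Gni x : {homo (G ^~ x) : n m / (n <= m)%N >-> m <= n}.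
  apply: homo_leq => [y|y z w yz zw|n]; [exact: lexx|exact: le_trans zw yz|].
  by rewrite /= ge_min lexx.
pose g' x := ereal_inf (range (G ^~ x)).
have Wg' : finite_wug u g' by exact: finite_wug_inf.
have bor k : finite_wug u k -> nonneg_borel_fun k by move=> [[]].
have g'G n x : g' x <= G n x by apply: ereal_inf_lbound; exists n.
have g'inf : energy g' <= ereal_inf S.
  apply: (@cvge_ge nat \oo _ R v) vS; apply: nearW => n.
  rewrite -(hP n).2; apply: le_q_energy => //; [exact: bor| |].
    by apply: bor; exact: (hP n).1.
  by move=> x; exact: le_trans (g'G n x) (Gh n x).
exists g'; split; [exact: Wg'.1|exact: Wg'.2|move=> k wk koo].
have Wk : finite_wug u k by [].
have Wm := finite_wug_min Wg' Wk.
have g'0 x : 0 <= g' x by exact: (bor _ Wg').2.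
have k0 x : 0 <= k x by exact: (bor _ Wk).2.
have m0 x : 0 <= mine (g' x) (k x) by rewrite le_min g'0 k0.
have : {ae cara, forall x, g' x `^ q <= mine (g' x) (k x) `^ q}.
  apply: ge0_le_integral_ae_eq.
  - exact: measurable_caraX (bor _ Wm).
  - exact: measurable_caraX (bor _ Wg').
  - by move=> x; exact: poweR_ge0.
  - by move=> x; apply: le_poweRq => //; rewrite ge_min lexx.
  - exact: Wg'.2.
  - by apply: (le_trans g'inf); apply: ereal_inf_lbound; exists (fun x => mine (g' x) (k x)).
apply: ae_mono => x H; have : g' x <= mine (g' x) (k x) by exact: poweRq_le_inv H.
by rewrite le_min => /andP[].
Qed.

(** What gives [nabla] its meaning: the choice made by [xget] succeeds, since a minimal weak upper
    gradient exists as soon as there is an upper gradient of finite energy. *)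
Lemma nablaP u : dirichlet mu q u ->
  minimal_weak_upper_gradient mu q u (nabla mu q u).
Proof.
move=> [_ [g ug goo]]; apply: xgetPex.
by apply: (@minimal_weak_upper_gradient_exists _ g); split => //; exact: upper_gradient_weak.
Qed.

End weak_upper_gradient_theory.

(** * Locality of the minimal weak upper gradient *)

Section metric_open.
Context {R : realType} {Y : metricType R}.

Lemma open_mdist_lt (x : Y) (r : R) : open [set y | mdist x y < r].
Proof.
rewrite openE => y /= xy; apply/nbhs_ballP; exists (r - mdist x y) => /=.
  by rewrite subr_gt0.
move=> z; rewrite ballEmdist/= ltrBrDl; apply: le_lt_trans.
exact: metric_triangle.
Qed.

End metric_open.

Section ae_countable.
Context d (T : measurableType d) (R : realType) (m : {measure set T -> \bar R}).

Lemma ae_forall_count (I : countType) (P : I -> T -> Prop) :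
  (forall i, {ae m, forall x, P i x}) -> {ae m, forall x i, P i x}.
Proof.
move=> H; pose Q n x := if unpickle n is Some i then P i x else True.
have : {ae m, forall x n, Q n x}.
  apply: ae_foralln => n; rewrite /Q; case: (unpickle n) => [i|]; first exact: H.
  exact: aeW.
by apply: filterS => x Qx i; have := Qx (pickle i); rewrite /Q pickleK.
Qed.

End ae_countable.

Section locality.
Context {R : realType} {X : pointedMetricType R}.
Variables (mu : {outer_measure set X -> \bar R}) (q : R).
Hypothesis mms : metric_measure_space mu.
Hypothesis q0 : 0 < q.
Local Open Scope ereal_scope.
Local Notation cara := (cara_measure mu).
Implicit Types (u h : X -> R).

Lemma borel_caratheodory : @borel R X `<=` mu.-caratheodory.
Proof. by have [_ []] := mms. Qed.

(** Regularity provides Borel hulls from outside; they are applied to the complement of A in balls D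
    n of finite measure. Removing the hull H n from D n leaves a Borel subset of A, and what is lost
    from A in D n is null. *)
Lemma borel_inner (A : set X) : mu.-caratheodory A ->
  exists B, [/\ borel B, B `<=` A & mu (A `\` B) = 0].
Proof.
move=> cA; have [_ [_ reg] _ bdd] := mms.
pose D n := [set y : X | (mdist point y < n.+1%:R)%R].
have bD n : borel (D n).
  by apply: sub_sigma_algebra; exact: open_mdist_lt.
have Doo n : mu (D n) < +oo.
  by apply: bdd; exists point, n.+1%:R; rewrite ballEmdist.
have cC n : mu.-caratheodory (D n `\` A).
  by apply: caratheodory_measurable_setD => //; exact: borel_caratheodory.
have /choice[H HP] n := reg (D n `\` A).
have bB n : borel (D n `\` H n).
  by apply: (@measurableD _ (borel_type X)); [exact: bD|have [] := HP n].
exists (\bigcup_n (D n `\` H n)); split.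
- by apply: (@bigcupT_measurable _ (borel_type X)).
- move=> x [n _ [Dx nHx]]; apply: contrapT => nAx; apply: nHx.
  by have [_ + _] := HP n; apply.
- pose N n := A `&` D n `&` H n.
  have N0 n : mu (N n) = 0.
    have [bH CH HC] := HP n.
    have Coo : mu (D n `\` A) \is a fin_num.
      rewrite ge0_fin_numE ?outer_measure_ge0//; apply: le_lt_trans (Doo n).
      by apply: le_outer_measure; exact: subDsetl.
    apply/le_anti; rewrite outer_measure_ge0 andbT.
    (* Testing the measurability of D n minus A on its hull, which has the same finite measure,
       shows that the hull exceeds it only by a null set. *)
    have := cC n (H n); rewrite (setIidr CH) HC => /eqP.
    rewrite -{1}[mu _]adde0 => /eqP E.
    have : mu (H n `&` ~` (D n `\` A)) = 0.
      by apply/le_anti; rewrite outer_measure_ge0 andbT -(@leeD2lE _ (mu (D n `\` A)))// -E.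
    move=> <-; apply: le_outer_measure => x [[Ax Dx] Hx]; split => // -[_]; exact.
  apply/le_anti; rewrite outer_measure_ge0 andbT.
  apply: (@le_trans _ _ (\sum_(n <oo) mu (N n))); last by rewrite eseries0.
  apply: le_trans (outer_measure_sigma_subadditive mu N).
  apply: le_outer_measure => x [Ax nBx].
  have [n nx] : exists n, (mdist point x < n.+1%:R)%R.
    by exists (Num.truncn (mdist point x)); exact: truncnS_gt.
  by exists n => //; split => //; apply: contrapT => nHx; apply: nBx; exists n.
Qed.

(** Replacing [nabla u] by [nabla h] on a Borel subset of A with null complement in A gives another
    weak upper gradient of u, and minimality compares [nabla u] with it. *)
Lemma nabla_le_on u h h' (A : set X) : dirichlet mu q u -> dirichlet mu q h ->
  (forall x y, `|h' x - h' y| = `|h x - h y|)%R ->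
  mu.-caratheodory A -> (forall x, A x -> u x = h' x) ->
  {ae cara, forall x, A x -> nabla mu q u x <= nabla mu q h x}.
Proof.
move=> du dh hh' cA uh; have bmu := borel_caratheodory.
have [wu uoo umin] := nablaP bmu q0 du; have [wh hoo _] := nablaP bmu q0 dh.
have wh' := weak_upper_gradient_osc hh' wh.
have [B [bB BA AB0]] := borel_inner cA.
have uB x : B x -> u x = h' x by move/BA; exact: uh.
have wk := weak_upper_gradient_glue bmu q0 bB uB wu uoo wh' hoo.
have koo := energy_glue bmu bB wu.1 uoo wh.1 hoo.
have aeB : {ae cara, forall x, ~ (A `\` B) x}.
  exists (A `\` B); split.
  - by apply: caratheodory_measurable_setD => //; exact: bmu.
  - exact: AB0.
  - by move=> x /= /contrapT.
apply: ae_mono2 aeB (umin _ wk koo) => x nAB + Ax.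
have Bx : B x by apply: contrapT => nBx; exact: nAB.
by rewrite !patchE in_setC (mem_set Bx) /= add0e.
Qed.

(** If h = |u - c i| at a point, then u = h + c i or u = - h + c i there. So countably many
    measurable coincidence sets cover K; [nabla_le_on] applies on each, and the exceptional null
    sets are united. *)
Lemma nabla_le_cover (I : countType) (c : I -> R) u h (K : set X) :
  dirichlet mu q u -> dirichlet mu q h ->
  (forall x, K x -> exists i, h x = `|u x - c i|%R) ->
  {ae cara, forall x, K x -> nabla mu q u x <= nabla mu q h x}.
Proof.
move=> du dh Kuh.
pose h' (ib : I * bool) x := ((if ib.2 then h x else - h x) + c ib.1)%R.
have : {ae cara, forall x ib, u x = h' ib x -> nabla mu q u x <= nabla mu q h x}.
  apply: ae_forall_count => -[i b];
    apply: (@nabla_le_on _ _ (h' (i, b)) [set x | u x = h' (i, b) x]) => //.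
    move=> x y; rewrite /h'/= opprD addrACA subrr addr0.
    by case: b => //; rewrite -opprD normrN.
  have [mu_ _] := du; have [mh_ _] := dh.
  have mh' : measurable_fun [set: caratheodory_type mu] (h' (i, b) : caratheodory_type mu -> R).
    rewrite /h'/=; apply: measurable_funD => //; case: b => //.
    exact: measurableT_comp.
  have := measurable_fun_eqr mu_ mh'.
  by move=> /(_ measurableT [set true] Logic.I); rewrite setTI; congr measurable;
    apply/seteqP; split => x /= /eqP.
apply: ae_mono => x H Kx; have [i hx] := Kuh x Kx.
have [ge|lt] := leP 0%R (u x - c i)%R.
  by apply: (H (i, true)); rewrite /h'/= hx ger0_norm// subrK.
by apply: (H (i, false)); rewrite /h'/= hx ltr0_norm// opprK subrK.
Qed.

End locality.

(** * Sawtooth functions and the McShane extension *)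

Section lipschitz_constructions.
Context {R : realType}.

(** T is the distance to 2 e Z: adding 1/2 before taking the floor makes [K s] an integer nearest to
    s / (2 e). As a minimum of the 1-Lipschitz functions |s - 2 e k|, T is 1-Lipschitz. *)
Lemma sawtooth_exists (e : R) : 0 < e -> exists T : R -> R,
  [/\ forall s t, `|T s - T t| <= `|s - t|, forall s, 0 <= T s <= e &
    forall s, exists k : int, T s = `|s - 2 * e * k%:~R|].
Proof.
move=> e0; pose K s : int := Num.floor (s / (2 * e) + 2^-1).
pose T s := `|s - 2 * e * (K s)%:~R|.
have e20 : 0 < 2 * e by rewrite mulr_gt0.
have Kle s : T s <= e.
  rewrite /T; have := floor_le_tmp (s / (2 * e) + 2^-1);
    have := floorD1_gt (s / (2 * e) + 2^-1).
  rewrite -/(K s) intrD; set k := (K s)%:~R => kgt kle.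
  have sE : s = 2 * e * (s / (2 * e)) by rewrite mulrC divfK// gt_eqF.
  rewrite sE; move: kgt kle; set z := s / (2 * e) => kgt kle.
  rewrite ler_norml; apply/andP; split; nra.
(* The point s is within e of 2 e K s, and every other multiple of 2 e is at least 2 e away from
   that one, hence at least e away from s. *)
have Tle s (k : int) : T s <= `|s - 2 * e * k%:~R|.
  have [->//|kK] := eqVneq k (K s).
  apply: le_trans (Kle s) _.
  have := Kle s; rewrite /T.
  have : 1 <= `|(K s)%:~R - k%:~R : R|.
    by rewrite -intrB -intr_norm ler1z -gtz0_ge1 normr_gt0 subr_eq0 eq_sym.
  set a := (K s)%:~R; set b := k%:~R => ab Ts.
  have : 2 * e <= `|2 * e * a - 2 * e * b|.
    by rewrite -mulrBr normrM (gtr0_norm e20) ler_peMr// ltW.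
  have := ler_distD s (2 * e * a) (2 * e * b); rewrite (distrC (2 * e * a) s).
  by lra.
have lip1 s t : T s <= T t + `|s - t|.
  apply: (le_trans (Tle s (K t))); rewrite /T [leRHS]addrC.
  exact: ler_distD.
exists T; split.
- move=> s t; rewrite ler_norml; have := lip1 s t; have := lip1 t s; rewrite (distrC t s).
  by move=> ? ?; apply/andP; split; lra.
- by move=> s; rewrite /T normr_ge0 Kle.
- by move=> s; exists (K s).
Qed.

Context {Y : metricType R}.
Implicit Types (u w : Y -> R).

(** McShane's formula u y = inf of w z + d(y, z) over z in K; nonnegativity of w bounds the infimum
    from below. For empty K there is nothing to take an infimum of, and the zero function is
    used. *)
Lemma lipschitz_extension (K : set Y) w : (forall y, 0 <= w y) ->
  (forall y z, K y -> K z -> `|w y - w z| <= mdist y z) ->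
  exists2 u : Y -> R, (forall y z, `|u y - u z| <= mdist y z) &
    forall y, K y -> u y = w y.
Proof.
move=> w0 wK; have [->|/set0P[z0 Kz0]] := eqVneq K set0.
  by exists (fun=> 0) => // y z; rewrite subrr normr0 mdist_ge0.
pose S y := [set w z + mdist y z | z in K].
have S0 y : S y !=set0 by exists (w z0 + mdist y z0); exists z0.
have Slb y : has_lbound (S y).
  by exists 0 => _ [z Kz <-]; rewrite addr_ge0 ?mdist_ge0.
pose u y := inf (S y).
have ule y z : K z -> u y <= w z + mdist y z.
  by move=> Kz; apply: (inf_lbound (Slb y)); exists z.
have uge y a : (forall z, K z -> a <= w z + mdist y z) -> a <= u y.
  by move=> H; apply: lb_le_inf (S0 y) _ => _ [z Kz <-]; exact: H.
have lip1 y y' : u y <= u y' + mdist y y'.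
  rewrite -lerBlDr; apply: uge => z Kz; rewrite lerBlDr.
  apply: (le_trans (ule y z Kz)); rewrite -addrA lerD2l addrC.
  exact: metric_triangle.
exists u.
- move=> y z; rewrite ler_norml; have := lip1 y z; have := lip1 z y; rewrite (metric_sym z y).
  by move=> ? ?; apply/andP; split; lra.
- move=> y Ky; apply/le_anti; rewrite (le_trans (ule y y Ky)) ?mdistxx ?addr0//=.
  apply: uge => z Kz; have := wK y z Ky Kz; rewrite ler_norml => /andP[_].
  by lra.
Qed.

Lemma lip_const_le1 u : lipschitz_fun u /\ (lip_const u <= 1)%E <->
  forall x y, `|u x - u y| <= mdist x y.
Proof.
split=> [[_ ul] x y|H]; last first.
  split; first by exists 1 => x y; rewrite mul1r.
  apply: ge_ereal_sup => _ [->|[x [y [xy ->]]]]; first exact: lee01.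
  by rewrite lee_fin ler_pdivrMr ?mdist_gt0// mul1r.
have [->|xy] := eqVneq x y; first by rewrite subrr normr0 mdist_ge0.
rewrite -[leRHS]mul1r -ler_pdivrMr ?mdist_gt0// -lee_fin; apply: le_trans ul.
by apply: ereal_sup_ubound; right; exists x, y.
Qed.

End lipschitz_constructions.

(** * The set function Psi *)

Section borel_extension.
Context {R : realType} {Y : pointedMetricType R}.
Local Open Scope ereal_scope.
Variable F : set Y -> \bar R.
Hypothesis F0 : F set0 = 0.
Hypothesis F_ge0 : forall A, 0 <= F A.
Hypothesis F_mono : forall A B, borel A -> borel B -> A `<=` B -> F A <= F B.
Hypothesis F_sub : forall B : (set Y)^nat, (forall n, borel (B n)) ->
  F (\bigcup_n B n) <= \sum_(n <oo) F (B n).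
Local Notation ext := (borel_inf_extension F).

Let borelI_bigcap (B : (set Y)^nat) : (forall n, borel (B n)) -> borel (\bigcap_n B n).
Proof. by move=> bB; exact: (@bigcapT_measurable _ (borel_type Y)). Qed.

Lemma borel_inf_extensionE (B : set Y) : borel B -> ext B = F B.
Proof.
move=> bB; apply/le_anti/andP; split; first by apply: ereal_inf_lbound; exists B => //; split.
by apply: le_ereal_inf_tmp => _ [C [BC bC] <-]; exact: F_mono.
Qed.

Lemma borel_inf_extension_le (A B : set Y) : borel B -> A `<=` B -> ext A <= F B.
Proof. by move=> bB AB; apply: ereal_inf_lbound; exists B. Qed.

(** The intersection of a minimizing sequence of Borel supersets is again a Borel superset. *)
Lemma borel_inf_extension_attained (A : set Y) :
  exists B, [/\ borel B, A `<=` B & F B = ext A].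
Proof.
pose S := [set F B | B in [set B | A `<=` B /\ borel B]].
have bT : borel [set: Y] by exact: (@measurableT _ (borel_type Y)).
have S0 : S != set0 by apply/set0P; exists (F setT); exists setT.
have [v Sv vS] := ereal_inf_seq S0.
have /choice[B BP] n : exists B : set Y, [/\ A `<=` B, borel B & F B = v n].
  by have [B [AB bB] Bv] := Sv n; exists B.
have bC : borel (\bigcap_n B n) by apply: borelI_bigcap => n; have [] := BP n.
have AC : A `<=` \bigcap_n B n by move=> x Ax n _; have [+ _ _] := BP n; apply.
exists (\bigcap_n B n); split => //; apply/le_anti/andP; split.
  apply: (@cvge_ge nat \oo _ R v) vS; apply: nearW => n.
  have [_ bB <-] := BP n; apply: F_mono => //; exact: bigcap_inf.
exact: borel_inf_extension_le.
Qed.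

Lemma borel_inf_extension_ge0 A : 0 <= ext A.
Proof. by apply: le_ereal_inf_tmp => _ [B _ <-]. Qed.

Lemma borel_inf_extension_mono : {homo ext : A B / A `<=` B >-> A <= B}.
Proof.
move=> A B AB; have [C [bC BC <-]] := borel_inf_extension_attained B.
by apply: borel_inf_extension_le => //; exact: subset_trans BC.
Qed.

Lemma borel_inf_extension0 : ext set0 = 0.
Proof. by rewrite borel_inf_extensionE//; exact: (@measurable0 _ (borel_type Y)). Qed.

Lemma borel_inf_extension_sigma_subadditive : sigma_subadditive ext.
Proof.
move=> A; have /choice[B BP] n := borel_inf_extension_attained (A n).
have bB n : borel (B n) by have [] := BP n.
apply: (@le_trans _ _ (F (\bigcup_n B n))).
  apply: borel_inf_extension_le; first exact: (@bigcupT_measurable _ (borel_type Y)).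
  by apply: subset_bigcup => n _; have [] := BP n.
apply: le_trans (F_sub bB) _.
by apply: lee_nneseries => // n _; have [_ _ <-] := BP n.
Qed.

(** A test set can be replaced by a Borel superset attaining the infimum, so splitting Borel sets
    makes closed sets Caratheodory measurable. The measurable sets form a sigma-algebra, which then
    contains all Borel sets. *)
Lemma borel_inf_extension_outer_measure :
  (forall A C, borel A -> closed C -> F (A `&` C) + F (A `\` C) <= F A) ->
  exists M : {outer_measure set Y -> \bar R},
    regular_borel M /\ forall A, M A = ext A.
Proof.
move=> Fadd; pose M : {outer_measure set Y -> \bar R} :=
  HB.pack ext (isOuterMeasure.Build R Y ext borel_inf_extension0
    borel_inf_extension_ge0 borel_inf_extension_mono borel_inf_extension_sigma_subadditive).
exists M; split => //; split; last first.
  move=> A; have [B [bB AB BA]] := borel_inf_extension_attained A.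
  by exists B; split => //; rewrite /= borel_inf_extensionE.
have mC C : closed C -> M.-caratheodory C.
  move=> cC; apply: le_caratheodory_measurable => A.
  have [B [bB AB BA]] := borel_inf_extension_attained A.
  have bC : borel C.
    rewrite -[C]setCK; apply: (@measurableC _ (borel_type Y)).
    by apply: sub_sigma_algebra; exact: closed_openC.
  rewrite /= -BA; apply: le_trans (Fadd _ _ bB cC); apply: leeD.
    apply: borel_inf_extension_le; first exact: (@measurableI _ (borel_type Y)).
    exact: setSI.
  apply: borel_inf_extension_le; first exact: (@measurableD _ (borel_type Y)).
  by rewrite setDE; exact: setSI.
apply: (smallest_sub (X := M.-caratheodory)).
- split; [exact: caratheodory_measurable_set0| |].
  + by move=> A mA; rewrite setTD; exact: caratheodory_measurable_setC.
  + exact: caratheodory_measurable_bigcup.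
- move=> U oU; rewrite -[U]setCK; apply: caratheodory_measurable_setC.
  by apply: mC; exact: open_closedC.
Qed.

End borel_extension.

(** For finite z, nonnegativity makes all summands finite, so each can be moved across by
    subtraction while the other runs through its supremum. *)
Lemma ereal_supD_le (R : realType) (S T : set \bar R) (z : \bar R) :
  S !=set0 -> T !=set0 -> (forall x, S x -> 0 <= x)%E -> (forall x, T x -> 0 <= x)%E ->
  (forall x y, S x -> T y -> x + y <= z)%E -> (ereal_sup S + ereal_sup T <= z)%E.
Proof.
move=> [x0 Sx0] [y0 Ty0] S0 T0 STz.
have [->|zoo] := eqVneq z +oo%E; first by rewrite leey.
have le_z (x y : \bar R) : (0 <= x -> 0 <= y -> x + y <= z -> x \is a fin_num)%E.
  move=> x0' y0' xyz; rewrite ge0_fin_numE//; apply: (@le_lt_trans _ _ z); last by rewrite ltey.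
  by apply: le_trans xyz; rewrite leeDl.
have supS y : T y -> (ereal_sup S + y <= z)%E.
  move=> Ty; have fy : y \is a fin_num.
    by apply: (le_z y x0); [exact: T0|exact: S0|rewrite addeC; exact: STz].
  rewrite -leeBrDr//; apply: ge_ereal_sup => x Sx.
  by rewrite leeBrDr// STz.
have sup0 : (0 <= ereal_sup S)%E by apply: le_trans (S0 _ Sx0) _; exact: ereal_sup_ubound.
have fS : ereal_sup S \is a fin_num by apply: (le_z _ y0) => //; [exact: T0|exact: supS].
rewrite addeC -leeBrDr//; apply: ge_ereal_sup => y Ty.
by rewrite leeBrDr// addeC supS.
Qed.

(** * Psi as a supremum of finite Borel measures *)

Section set_function_Psi.
Context {R : realType} {X Y : pointedMetricType R}.
Variables (mu : {outer_measure set X -> \bar R}) (q : R) (phi : X -> Y).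
Hypothesis mms : metric_measure_space mu.
Hypothesis q0 : 0 < q.
Hypothesis mphi : measurable_mapping mu phi.
Hypothesis dphi : forall u : Y -> R, lipschitz_fun u -> dirichlet mu q (u \o phi).
Local Open Scope ereal_scope.
Local Notation cara := (cara_measure mu).
Implicit Types (u v : Y -> R) (A B C : set Y).

Definition lip1 u := forall x y, (`|u x - u y| <= mdist x y)%R.

(** Push-forward under [phi] of the measure with density |nabla_q (u o phi)|^q. *)
Definition Psi_of u A := q_energy mu q (phi @^-1` A) (nabla mu q (u \o phi)).

Lemma lip1_nabla u : lip1 u ->
  minimal_weak_upper_gradient mu q (u \o phi) (nabla mu q (u \o phi)).
Proof.
move=> u1; apply: nablaP => //; first exact: borel_caratheodory.
by apply: dphi; exists 1%R => x y; rewrite mul1r.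
Qed.

Lemma measurable_nabla u : lip1 u -> measurable_fun [set: caratheodory_type mu]
  ((fun x => nabla mu q (u \o phi) x `^ q) : caratheodory_type mu -> \bar R).
Proof.
move=> /lip1_nabla[[bn _] _ _].
by apply: measurable_caraX => //; exact: borel_caratheodory.
Qed.

Lemma measurable_preimage A : borel A ->
  measurable (phi @^-1` A : set (caratheodory_type mu)).
Proof. by move=> bA; rewrite -[X in measurable X]setTI; exact: mphi. Qed.

Lemma Psi_of_ge0 u A : 0 <= Psi_of u A.
Proof. exact: q_energy_ge0. Qed.

Lemma Psi_of_mono u A B : lip1 u -> borel A -> borel B -> A `<=` B ->
  Psi_of u A <= Psi_of u B.
Proof.
move=> u1 bA bB AB; apply: ge0_subset_integral.
- exact: measurable_preimage.
- exact: measurable_preimage.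
- by apply: measurable_funTS; exact: measurable_nabla.
- by move=> x _; exact: poweR_ge0.
- exact: preimage_subset.
Qed.

Lemma Psi_of_fin u A : lip1 u -> borel A -> Psi_of u A \is a fin_num.
Proof.
move=> u1 bA; rewrite ge0_fin_numE ?Psi_of_ge0//.
have [_ uoo _] := lip1_nabla u1; apply: le_lt_trans uoo.
have -> : q_energy mu q setT (nabla mu q (u \o phi)) = Psi_of u setT.
  by rewrite /Psi_of preimage_setT.
by apply: Psi_of_mono => //; exact: (@measurableT _ (borel_type Y)).
Qed.

Lemma Psi_ofU u A B : lip1 u -> borel A -> borel B -> [disjoint A & B] ->
  Psi_of u (A `|` B) = Psi_of u A + Psi_of u B.
Proof.
move=> u1 bA bB AB; rewrite /Psi_of preimage_setU; apply: ge0_integral_setU.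
- exact: measurable_preimage.
- exact: measurable_preimage.
- by apply: measurable_funTS; exact: measurable_nabla.
- by move=> x _; exact: poweR_ge0.
- by apply/disj_setPS => x [Ax Bx]; move/disj_setPS: AB => /(_ (phi x)); apply.
Qed.

Lemma Psi_of_sigma_subadditive u (B : (set Y)^nat) : lip1 u -> (forall n, borel (B n)) ->
  Psi_of u (\bigcup_n B n) <= \sum_(n <oo) Psi_of u (B n).
Proof.
move=> u1 bB; rewrite seqDU_bigcup_eq.
have bD n : borel (seqDU B n).
  apply: (@measurableD _ (borel_type Y)); first exact: bB.
  by apply: (@bigsetU_measurable _ (borel_type Y)) => k _; exact: bB.
rewrite /Psi_of /q_energy preimage_bigcup ge0_integral_bigcup.
- apply: lee_nneseries => n; first by move=> _ _; exact: Psi_of_ge0.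
  by move=> _; apply: Psi_of_mono => //; exact: subset_seqDU.
- by move=> n; exact: measurable_preimage.
- by apply: measurable_funTS; exact: measurable_nabla.
- by move=> x _; exact: poweR_ge0.
- by move=> i j _ _ [x [Bi Bj]]; apply: (@trivIset_seqDU _ B) => //; exists (phi x).
Qed.

Lemma PsiE A : Psi mu q phi q A = ereal_sup [set Psi_of u A | u in lip1].
Proof.
congr ereal_sup; apply/seteqP; split => _ [u uP <-]; exists u => //.
- exact/lip_const_le1.
- by rewrite divff ?gt_eqF// poweRe1// Psi_of_ge0.
- exact/lip_const_le1.
- by rewrite divff ?gt_eqF// poweRe1// Psi_of_ge0.
Qed.

Lemma Psi_of_le u A : lip1 u -> Psi_of u A <= Psi mu q phi q A.
Proof. by move=> u1; rewrite PsiE; apply: ereal_sup_ubound; exists u. Qed.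

Lemma lip1_cst : lip1 (fun=> 0%R).
Proof. by move=> x y; rewrite subrr normr0 mdist_ge0. Qed.

Lemma Psi_ge0 A : 0 <= Psi mu q phi q A.
Proof. exact: le_trans (Psi_of_ge0 _ _) (Psi_of_le _ lip1_cst). Qed.

Lemma Psi0 : Psi mu q phi q set0 = 0.
Proof.
apply/le_anti; rewrite Psi_ge0 andbT PsiE; apply: ge_ereal_sup => _ [u _ <-].
by rewrite /Psi_of preimage_set0 /q_energy integral_set0.
Qed.

Lemma Psi_mono A B : borel A -> borel B -> A `<=` B ->
  Psi mu q phi q A <= Psi mu q phi q B.
Proof.
move=> bA bB AB; rewrite [leLHS]PsiE; apply: ge_ereal_sup => _ [u u1 <-].
by apply: le_trans (Psi_of_le _ u1); exact: Psi_of_mono.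
Qed.

Lemma Psi_sigma_subadditive (B : (set Y)^nat) : (forall n, borel (B n)) ->
  Psi mu q phi q (\bigcup_n B n) <= \sum_(n <oo) Psi mu q phi q (B n).
Proof.
move=> bB; rewrite [leLHS]PsiE; apply: ge_ereal_sup => _ [u u1 <-].
apply: (le_trans (Psi_of_sigma_subadditive u1 bB)).
by apply: lee_nneseries => n; [move=> _ _; exact: Psi_of_ge0|move=> _; exact: Psi_of_le].
Qed.

(* Locally u = v + 2 e k or u = - v + 2 e k, so u and v have the same gradient. *)
Lemma Psi_of_sawtooth u v (e : R) A K : lip1 u -> lip1 v -> borel A -> A `<=` K ->
  (forall y, K y -> exists k : int, v y = `|u y - 2 * e * k%:~R|%R) ->
  Psi_of u A <= Psi_of v A.
Proof.
move=> u1 v1 bA AK uv; apply: ae_ge0_le_integral.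
- exact: measurable_preimage.
- by move=> x _; exact: poweR_ge0.
- by apply: measurable_funTS; exact: measurable_nabla.
- by move=> x _; exact: poweR_ge0.
- by apply: measurable_funTS; exact: measurable_nabla.
have lipd w : lip1 w -> dirichlet mu q (w \o phi).
  by move=> w1; apply: dphi; exists 1%R => x y; rewrite mul1r.
have := @nabla_le_cover _ _ mu q mms q0 int (fun k => (2 * e * k%:~R)%R)
  (u \o phi) (v \o phi) (phi @^-1` A) (lipd _ u1) (lipd _ v1).
move=> /(_ (fun x Ax => uv _ (AK _ Ax))).
apply: ae_mono => x H Ax; apply: le_poweRq => //; last exact: H.
by have [[[_ ->]]] := lip1_nabla u1.
Qed.

(** A single 1-Lipschitz v, extending T o u1 from C and T o u2 from D, does at least as well as u1
    on C and as u2 on D, and its measure is additive on these disjoint sets. *)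
Lemma Psi_of_separated u1 u2 A C (e : R) : lip1 u1 -> lip1 u2 -> borel A -> closed C ->
  (0 < e)%R ->
  let D := [set y | forall z, C z -> (e <= mdist z y)%R] in
  borel (A `&` D) -> borel (A `&` C) ->
  Psi_of u1 (A `&` C) + Psi_of u2 (A `&` D) <= Psi mu q phi q A.
Proof.
move=> lu1 lu2 bA cC e0 D bAD bAC.
have CD : [disjoint C & D].
  by apply/disj_setPS => y [Cy Dy]; have := Dy y Cy; rewrite mdistxx leNgt e0.
have [T [Tlip T0e Tk]] := sawtooth_exists e0.
pose w y := if y \in C then T (u1 y) else T (u2 y).
have DnC y : D y -> (y \in C) = false.
  by move=> Dy; apply/negbTE; rewrite notin_setE => Cy; move/disj_setPS : CD => /(_ y); apply.
have wlip y z : (C `|` D) y -> (C `|` D) z -> (`|w y - w z| <= mdist y z)%R.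
  (* T has values in [0, e], so two of its values differ by at most e, which bounds the distance
     between points of C and D from below. This settles the mixed pairs. *)
  have Te s t : (`|T s - T t| <= e)%R.
    by have := T0e s; have := T0e t => /andP[? ?] /andP[? ?]; rewrite ler_norml; apply/andP;
      split; lra.
  move=> [Cy|Dy] [Cz|Dz]; rewrite /w.
  - by rewrite !mem_set//; exact: le_trans (Tlip _ _) (lu1 _ _).
  - by rewrite mem_set// DnC//; apply: le_trans (Te _ _) _; exact: Dz.
  - by rewrite DnC// mem_set//; apply: le_trans (Te _ _) _; rewrite metric_sym; exact: Dy.
  - by rewrite !DnC//; exact: le_trans (Tlip _ _) (lu2 _ _).
have w0 y : (0 <= w y)%R by rewrite /w; case: ifP => _; have := T0e (u1 y);
  have := T0e (u2 y); lra.
have [v lv vw] := lipschitz_extension w0 wlip.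
have le1 : Psi_of u1 (A `&` C) <= Psi_of v (A `&` C).
  apply: (@Psi_of_sawtooth _ _ e _ C) => // y Cy; have [k uk] := Tk (u1 y).
  by exists k; rewrite vw; [rewrite /w mem_set|left].
have le2 : Psi_of u2 (A `&` D) <= Psi_of v (A `&` D).
  apply: (@Psi_of_sawtooth _ _ e _ D) => // y Dy; have [k uk] := Tk (u2 y).
  by exists k; rewrite vw; [rewrite /w DnC|right].
apply: (le_trans (leeD le1 le2)); rewrite -Psi_ofU//; last first.
  by apply/disj_setPS => y [[_ Cy] [_ Dy]]; move/disj_setPS : CD => /(_ y); apply.
apply: le_trans (Psi_of_le _ lv); apply: Psi_of_mono => //.
- exact: (@measurableU _ (borel_type Y)).
- by move=> y [[]|[]].
Qed.

(** As C is closed, the sets [D n] of points at distance at least 1 / (n + 1) from C exhaust its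
    complement. Continuity from below of the measure [Psi_of u2] then carries [Psi_of_separated] to
    the limit. *)
Lemma Psi_closed_split A C : borel A -> closed C ->
  Psi mu q phi q (A `&` C) + Psi mu q phi q (A `\` C) <= Psi mu q phi q A.
Proof.
move=> bA cC.
have bC : borel C.
  rewrite -[C]setCK; apply: (@measurableC _ (borel_type Y)).
  by apply: sub_sigma_algebra; exact: closed_openC.
have bAC : borel (A `&` C) by exact: (@measurableI _ (borel_type Y)).
rewrite (PsiE (A `&` C)) (PsiE (A `\` C)); apply: ereal_supD_le.
- by eexists; exists (fun=> 0%R) => //; exact: lip1_cst.
- by eexists; exists (fun=> 0%R) => //; exact: lip1_cst.
- by move=> _ [u _ <-]; exact: Psi_of_ge0.
- by move=> _ [u _ <-]; exact: Psi_of_ge0.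
move=> _ _ [u1 lu1 <-] [u2 lu2 <-].
pose e n : R := n.+1%:R^-1%R.
pose D n := [set y | forall z, C z -> (e n <= mdist z y)%R].
have bD n : borel (D n).
  rewrite -[D n]setCK; apply: (@measurableC _ (borel_type Y)); apply: sub_sigma_algebra.
  have -> : ~` D n = \bigcup_(z in C) [set y | (mdist z y < e n)%R].
    apply/seteqP; split => y /=.
      move=> /existsNP[z /not_implyP[Cz /negP]]; rewrite -ltNge => zy; by exists z.
    by move=> [z Cz /=]; rewrite ltNge => /negP zy Dy; apply: zy; exact: Dy.
  by apply: bigcup_open => z _; exact: open_mdist_lt.
have bAD n : borel (A `&` D n) by exact: (@measurableI _ (borel_type Y) _ _ bA (bD n)).
have DC : A `\` C = \bigcup_n (A `&` D n).
  apply/seteqP; split => y.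
    move=> [Ay nCy]; have oC : open (~` C) by exact: closed_openC.
    have /nbhs_ballP[r /= r0 rC] := open_nbhs_nbhs (conj oC nCy).
    have [n nr] : exists n, (e n < r)%R.
      have [n] := ltr_add_invr (y := 0%R) (x := r) r0; rewrite add0r => nr.
      by exists n.
    exists n => //; split => // z Cz; rewrite leNgt; apply/negP => zy.
    by apply: (rC z) => //; rewrite ballEmdist/= metric_sym; exact: lt_trans nr.
  move=> [n _ [Ay Dy]]; split => // Cy; have := Dy y Cy.
  by rewrite mdistxx leNgt invr_gt0 ltr0n.
(* The term of u1 does not depend on n and is finite; subtracting it leaves an upper bound for a
   single limit. *)
rewrite addeC -leeBrDr ?Psi_of_fin//.
have cvgD : Psi_of u2 (A `&` D n) @[n --> \oo] --> Psi_of u2 (A `\` C).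
  rewrite DC /Psi_of preimage_bigcup; apply: ge0_nondecreasing_set_cvg_integral.
  - move=> n m nm; apply/subsetPset => x [Ax Dx]; split => // z Cz.
    apply: le_trans (Dx z Cz); rewrite lef_pV2 ?posrE ?ltr0n// ler_nat.
    by rewrite ltnS.
  - by move=> n; exact: measurable_preimage.
  - by move=> n; apply: measurable_funTS; exact: measurable_nabla.
  - by move=> n x _; exact: poweR_ge0.
apply: (@cvge_le nat \oo _ R _ _ _ _ cvgD); apply: nearW => n.
rewrite leeBrDr ?Psi_of_fin// addeC.
have en0 : (0 < e n)%R by rewrite invr_gt0 ltr0n.
exact: (Psi_of_separated lu1 lu2 bA cC en0 (bAD n) bAC).
Qed.

End set_function_Psi.

Theorem theorem3p5 (R : realType) (X Y : pointedMetricType R)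
  (mu : {outer_measure set X -> \bar R}) (nu : {outer_measure set Y -> \bar R})
  (q sigma : R) (phi : X -> Y)
  (mms_mu : metric_measure_space mu) (mms_nu : metric_measure_space nu)
  (q_ge1 : 1 <= q) (sigmaE : sigma = q)
  (mphi : measurable_mapping mu phi)
  (bphi : bounded_composition_operator mu q phi) :
  exists Psit : {outer_measure set Y -> \bar R},
    [/\ regular_borel Psit,
        forall A : set Y, Psit A = borel_inf_extension (Psi mu q phi sigma) A &
        forall U : set Y, borel U -> Psit U = Psi mu q phi sigma U].
Proof.
have q0 : 0 < q by exact: lt_le_trans ltr01 q_ge1.
have [dphi _] := bphi; rewrite sigmaE.
have mono : forall A B, borel A -> borel B -> A `<=` B ->
  (Psi mu q phi q A <= Psi mu q phi q B)%E by move=> A B; exact: Psi_mono.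
have [||||| M [rM ME]] := @borel_inf_extension_outer_measure _ _ (Psi mu q phi q).
- exact: Psi0.
- by move=> A; exact: Psi_ge0.
- exact: mono.
- by move=> B; exact: Psi_sigma_subadditive.
- by move=> A C; exact: Psi_closed_split.
exists M; split => // U bU.
by rewrite ME; exact: borel_inf_extensionE.
Qed.
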